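(* Let $p\in(1,\infty)$, $q\in[1,p]$, $s\in\mathbb{Z}_+$ and $\alpha\in(0,\infty)$, and let $\mathcal{X}$ be $\mathbb{R}^n$ or a cube $Q_0\subsetneqq\mathbb{R}^n$. Then $jn_{(p,q,s)_{\alpha}}(\mathcal{X})=JN_{(p,q,s)_{\alpha}}(\mathcal{X})\cap L^p(\mathcal{X})$ with equivalent norms, where the intersection is equipped with $\max\{\|\cdot\|_{JN_{(p,q,s)_{\alpha}}(\mathcal{X})},\|\cdot\|_{L^p(\mathcal{X})}\}$.
   Context: $\mathbb{Z}_+=\{0,1,2,\dots\}$. A cube $Q\subset\mathbb{R}^n$ has edges parallel to the coordinate axes and finite positive side length $\ell(Q)$, and is not necessarily closed; $\ell(\mathbb{R}^n):=\infty$. $\fint_Q f:=\frac1{|Q|}\int_Q f$. Functions are measurable and identified when equal almost everywhere. $L^q_{\mathrm{loc}}(\mathcal{X})$ is the set of measurable $f$ with $f\mathbf{1}_E\in L^q(\mathcal{X})$ for every bounded $E\subset\mathcal{X}$. For $f\in L^1(Q)$, $P^{(s)}_Q(f)$ is the unique polynomial on $Q$ of degree at most $s$ with $\int_Q[f(x)-P^{(s)}_Q(f)(x)]x^\beta\,dx=0$ for all $\beta\in\mathbb{Z}_+^n$, $|\beta|\le s$. Fix $c_0\in(0,\ell(\mathcal{X}))$. Let $P^{(s)}_{Q,c_0}(f):=P^{(s)}_Q(f)$ if $\ell(Q)<c_0$ and $P^{(s)}_{Q,c_0}(f):=0$ if $\ell(Q)\ge c_0$. $jn_{(p,q,s)_\alpha}(\mathcal{X})$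 is the set of all $f\in L^q_{\mathrm{loc}}(\mathcal{X})$ with $$\|f\|_{jn_{(p,q,s)_\alpha}(\mathcal{X})}:=\sup\Big[\sum_{j}|Q_j|\Big\{|Q_j|^{-\alpha}\Big[\fint_{Q_j}|f-P^{(s)}_{Q_j,c_0}(f)|^q\Big]^{1/q}\Big\}^p\Big]^{1/p}<\infty,$$ the supremum being over all countable (finite or infinite) collections $\{Q_j\}_j$ of cubes in $\mathcal{X}$ with pairwise disjoint interiors. $JN_{(p,q,s)_\alpha}(\mathcal{X})$ and $\|\cdot\|_{JN_{(p,q,s)_\alpha}(\mathcal{X})}$ (a seminorm) are defined in the same way with $P^{(s)}_{Q_j,c_0}(f)$ replaced by $P^{(s)}_{Q_j}(f)$. *)

(* Defs.v *)
From HB Require Import structures.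
From mathcomp Require Import all_boot all_order all_algebra.
(* Both the notations and the name isMeasure of mpoly clash with those of
   MathComp-Analysis, hence the filter and the order. *)
From mathcomp Require Import -(notations) mpoly.
From mathcomp Require Import all_classical all_reals all_analysis.

Set Implicit Arguments.
Unset Strict Implicit.
Unset Printing Implicit Defensive.
Import Order.TTheory GRing.Theory Num.Theory.
Import numFieldNormedType.Exports.

Local Open Scope classical_set_scope.
Local Open Scope ring_scope.

(* R^n is n.-tuple R, whose library sigma-algebra is the one generated by the
   coordinates, i.e. the Borel sets. As for Lfun and Lspace, "measurable" means
   Borel measurable; every Lebesgue measurable function has such a version.
   Tuples carry no topology in the library: interior and boundedness are those
   of the image in the normed space 'rV[R]_n under vec_of. *)

Definition vec_of (R : realType) (n : nat) (x : n.-tuple R) : 'rV[R]_n :=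
  \row_(i < n) tnth x i.

Section lebesgue_measure_tuple.
Context {R : realType}.

(* measurableTypeR R is R with the structure over which lebesgue_measure is
   declared. *)
Definition cons_tuple (n : nat) (z : n.-tuple R * measurableTypeR R) :
  n.+1.-tuple R := [the n.+1.-tuple R of z.2 :: z.1].

Lemma measurable_cons_tuple (n : nat) : measurable_fun setT (@cons_tuple n).
Proof.
apply: (@measurable_cons _ _ _ _ (fun z => z.2 : R)); last exact: measurable_fst.
by move=> mT Y mY; exact: measurable_snd.
Qed.

HB.instance Definition _ (n : nat) :=
  isMeasurableFun.Build _ _ _ _ (@cons_tuple n) (@measurable_cons_tuple n).

Section step.
Variables (n : nat) (mu : {measure set (n.-tuple R) -> \bar R}).

Definition lebesgue_step : set (n.+1.-tuple R) -> \bar R :=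
  pushforward (mu \x lebesgue_measure)%E (@cons_tuple n).

Let lebesgue_step0 : lebesgue_step set0 = 0%E.
Proof. exact: measure0. Qed.

Let lebesgue_step_ge0 A : (0 <= lebesgue_step A)%E.
Proof. exact: measure_ge0. Qed.

Let lebesgue_step_sigma_additive : semi_sigma_additive lebesgue_step.
Proof. exact: measure_semi_sigma_additive. Qed.

HB.instance Definition _ := isMeasure.Build _ _ _ lebesgue_step
  lebesgue_step0 lebesgue_step_ge0 lebesgue_step_sigma_additive.

End step.

Fixpoint lebesgue_measure_tuple (n : nat) :
    {measure set (n.-tuple R) -> \bar R} :=
  match n with
  | 0%N => \d_ [tuple]
  | m.+1 => lebesgue_step (lebesgue_measure_tuple m)
  end.

Lemma measurable_tuple_box (n : nat) (A : 'I_n -> set R) :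
  (forall i, measurable (A i)) ->
  measurable [set x : n.-tuple R | forall i, A i (tnth x i)].
Proof.
move=> mA.
rewrite (_ : mkset _ = \bigcap_i ((fun x : n.-tuple R => tnth x i) @^-1` A i)).
  apply: fin_bigcap_measurable => [|i _]; first exact: finite_finset.
  by rewrite -[X in measurable X]setTI; exact: measurable_tnth.
by apply/seteqP; split=> x /= xA i; [move=> _|]; exact: xA.
Qed.

Lemma lebesgue_measure_tuple_box (n : nat) (A : 'I_n -> set R) :
  (forall i, measurable (A i)) ->
  lebesgue_measure_tuple n [set x | forall i, A i (tnth x i)] =
    (\prod_(i < n) lebesgue_measure (A i))%E.
Proof.
elim: n A => [|n IH] A mA /=.
  by rewrite big_ord0 diracE mem_set//= => -[].
rewrite big_ord_recl /= /lebesgue_step /pushforward.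
pose B := [set x : n.-tuple R | forall i, A (lift ord0 i) (tnth x i)].
have mB : measurable B.
  by apply: (measurable_tuple_box (A := fun i => A (lift ord0 i))) => i; exact: mA.
rewrite (_ : _ @^-1` _ = B `*` A ord0); first last.
  apply/seteqP; split=> [[x y] /= xyA|[x y] /= [xB yA] i].
    by split=> [i|]; [have := xyA (lift ord0 i); rewrite tnthS
                     |have := xyA ord0; rewrite tnth0].
  by have [j ->|->] := unliftP ord0 i; rewrite ?tnthS ?tnth0//; exact: xB.
rewrite (product_measure1E (lebesgue_measure_tuple n) lebesgue_measure mB (mA ord0)).
by rewrite muleC (IH (fun i => A (lift ord0 i)))// => i; exact: mA.
Qed.

End lebesgue_measure_tuple.

Section jn_spaces.
Context {R : realType} {n : nat}.
Local Notation T := (n.-tuple R).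
Local Notation mu := (@lebesgue_measure_tuple R n).

(* The booleans select, for each coordinate, whether each of the two faces
   belongs to the cube: BSide b a is the bound just before a if b is true, just
   after a otherwise. *)
Record cube := Cube {
  cube_corner : T;
  cube_side : R;
  cube_lbound : 'I_n -> bool;
  cube_rbound : 'I_n -> bool;
  cube_side_gt0 : 0 < cube_side
}.

Definition cube_set (Q : cube) : set T :=
  [set x | forall i, tnth x i \in
    Interval (BSide (cube_lbound Q i) (tnth (cube_corner Q) i))
             (BSide (cube_rbound Q i) (tnth (cube_corner Q) i + cube_side Q))].

Variant domain := WholeSpace | InCube of cube.

Definition domain_set (X : domain) : set T :=
  if X is InCube Q then cube_set Q else setT.

Definition domain_side (X : domain) : \bar R :=
  if X is InCube Q then (cube_side Q)%:E else +oo%E.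

Definition Lq_loc (X : domain) (q : R) : set (T -> R) :=
  [set f | measurable_fun (domain_set X) f /\
    forall E : set T, measurable E -> E `<=` domain_set X ->
      bounded_set (@vec_of R n @` E) -> f \_ E \in Lfun mu q%:E].

Definition Lp_norm (X : domain) (p : R) (f : T -> R) : \bar R :=
  'N[mu]_p%:E [EFin \o (f \_ (domain_set X))]%E.

Definition Lp (X : domain) (p : R) : set (T -> R) :=
  [set f | f \_ (domain_set X) \in Lfun mu p%:E].

Definition poly_eval (P : mpoly n R) (x : T) : R := meval (tnth x) P.

(* msize is the total degree plus one, and 0 for the zero polynomial. *)
Definition is_poly_proj (s : nat) (Q : cube) (f : T -> R)
    (P : mpoly n R) : Prop :=
  (msize P <= s.+1)%N /\
  forall beta : 'I_n -> nat, (\sum_(i < n) beta i <= s)%N ->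
    (\int[mu]_(x in cube_set Q)
      ((f x - poly_eval P x) * \prod_(i < n) tnth x i ^+ beta i)%:E = 0)%E.

Definition poly_proj (s : nat) (Q : cube) (f : T -> R) : mpoly n R :=
  xget 0 [set P | is_poly_proj s Q f P].

Definition poly_proj_c0 (c0 : R) (s : nat) (Q : cube) (f : T -> R) :
    mpoly n R :=
  if cube_side Q < c0 then poly_proj s Q f else 0.

Definition cube_families (X : domain) : set (set nat * (nat -> cube)) :=
  [set DQ | (forall j, DQ.1 j -> cube_set (DQ.2 j) `<=` domain_set X) /\
    trivIset DQ.1 (fun j => (@vec_of R n @` cube_set (DQ.2 j))°)].

Local Open Scope ereal_scope.

Definition mean_oscillation (q : R) (Q : cube) (f : T -> R)
    (P : mpoly n R) : \bar R :=
  (mu (cube_set Q))^-1 *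
    \int[mu]_(x in cube_set Q) (`|f x - poly_eval P x| `^ q)%:E.

Definition jn_summand (p q alpha : R) (Q : cube) (f : T -> R)
    (P : mpoly n R) : \bar R :=
  mu (cube_set Q) *
    (mu (cube_set Q) `^ (- alpha) * mean_oscillation q Q f P `^ q^-1) `^ p.

Definition norm_with (proj : cube -> (T -> R) -> mpoly n R)
    (X : domain) (p q alpha : R) (f : T -> R) : \bar R :=
  ereal_sup [set
    (\esum_(j in DQ.1) jn_summand p q alpha (DQ.2 j) f (proj (DQ.2 j) f)) `^ p^-1
    | DQ in cube_families X].

Definition JN_norm (p q : R) (s : nat) (alpha : R) (X : domain) :=
  norm_with (poly_proj s) X p q alpha.

Definition jn_norm (c0 p q : R) (s : nat) (alpha : R) (X : domain) :=
  norm_with (poly_proj_c0 c0 s) X p q alpha.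

Definition JN (p q : R) (s : nat) (alpha : R) (X : domain) : set (T -> R) :=
  [set f | Lq_loc X q f /\ JN_norm p q s alpha X f < +oo].

Definition jn (c0 p q : R) (s : nat) (alpha : R) (X : domain) : set (T -> R) :=
  [set f | Lq_loc X q f /\ jn_norm c0 p q s alpha X f < +oo].

End jn_spaces.

Arguments cube R n : clear implicits.
Arguments domain R n : clear implicits.

(* Main.v *)
(* A polynomial of degree at most s is bounded on a cube by a constant times its
   average: in dimension one by interpolating at s+1 well separated points where
   the polynomial is smallest, in higher dimension by induction, freezing one
   coordinate. Hence the orthogonal projection P_Q f is bounded by the average of
   |f|, which gives JN <= C jn, as only the cubes of side at least c0 differ.

   On a cube of side at least c0, Jensen's inequality bounds the summand of the jn
   norm by the integral of |f|^p over the cube. These cubes overlap in null sets,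
   so jn <= B max(JN, L^p).

   For L^p <= M jn, tile the domain by dyadic grids of mesh L 2^-k, with L >= c0,
   and let G_k be the piecewise polynomial P_Q f on the k-th grid; G_0 = 0 since
   L >= c0. The k-th grid being an admissible family, the oscillations O_k satisfy
   |O_k|_p <= (L 2^-k)^(n alpha) jn, and |G_{k+1} - G_k| <= K (O_{k+1} + O_k)
   pointwise. As alpha > 0 the series is geometric, hence |G_k|_p <= M jn. On each
   cell of the coarsest grid the integrals of |f - G_k| are summable, so G_k -> f
   almost everywhere, and Fatou's lemma concludes. *)
Require Import Defs.
From HB Require Import structures.
From mathcomp Require Import all_boot all_order all_algebra.
From mathcomp Require Import -(notations) mpoly.
From mathcomp Require Import all_classical all_reals all_analysis.
From mathcomp Require Import measurable_realfun.
From mathcomp Require Import ring lra.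

Set Implicit Arguments.
Unset Strict Implicit.
Unset Printing Implicit Defensive.
Import Order.TTheory GRing.Theory Num.Theory.
Import numFieldNormedType.Exports.

Local Open Scope classical_set_scope.
Local Open Scope ring_scope.

(** * Polynomials are bounded by their averages *)

Lemma poly_le_separated (R : realFieldType) (rho : R) (s : nat) : 0 <= rho ->
  exists2 K : R, 0 < K &
    forall (t : nat -> R) (d M : R) (g : {poly R}) (x : R),
      0 < d -> (size g <= s.+1)%N ->
      (forall i j, (i < j <= s)%N -> d <= `|t j - t i|) ->
      (forall i, (i <= s)%N -> `|g.[t i]| <= M) ->
      (forall i, (i <= s)%N -> `|x - t i| <= rho * d) ->
      `|g.[x]| <= K * M.
Proof.
(* Divide [g - g(t 0)] by ['X - t 0] and induct on the quotient. *)
move=> rho0; elim: s => [|s [K K0 IH]].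
  exists 1 => // t d M g x _ /size1_polyC -> _ gM _.
  by have := gM 0%N isT; rewrite !hornerC mul1r.
(* From |g(x)| <= |g(t 0)| + |g1(x)| |x - t 0|: the quotient is at most 2M/d at the remaining
   points, hence at most 2KM/d at x, and |x - t 0| <= rho d. *)
exists (1 + 2 * rho * K); first by rewrite ltr_pwDl// !mulr_ge0// ltW.
move=> t d M g x d0 sg td gM xt.
have : root (g - (g.[t 0%N])%:P) (t 0%N) by rewrite rootE !hornerE subrr.
case/factor_theorem => g1 gE.
have gxE y : g.[y] = g.[t 0%N] + g1.[y] * (y - t 0%N).
  by move/(congr1 (horner^~ y)): gE; rewrite !hornerE => <-; rewrite addrC subrK.
have M0 : 0 <= M by apply: le_trans (gM 0%N isT).
have sg1 : (size g1 <= s.+1)%N.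
  have [->|g10] := eqVneq g1 0; first by rewrite size_poly0.
  have : (size (g1 * ('X - (t 0%N)%:P))%R <= s.+2)%N.
    rewrite -gE; apply: leq_trans (size_polyD _ _) _.
    by rewrite geq_max sg size_polyN (leq_trans (size_polyC_leq1 _) _).
  by rewrite size_Mmonic ?monicXsubC ?size_XsubC ?addn2.
have g1M i : (i <= s)%N -> `|g1.[t i.+1]| <= 2 * M / d.
  move=> is_; rewrite ler_pdivlMr//.
  apply: (@le_trans _ _ (`|g1.[t i.+1]| * `|t i.+1 - t 0%N|)).
    by rewrite ler_wpM2l//; exact: td.
  rewrite -normrM (_ : g1.[_] * _ = g.[t i.+1] - g.[t 0%N]); last first.
    by rewrite (gxE (t i.+1)) addrAC subrr add0r.
  rewrite (le_trans (ler_normB _ _))// mulr_natl mulr2n lerD//; exact: gM.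
have := IH (t \o S) d (2 * M / d) g1 x d0 sg1 (fun i j => td i.+1 j.+1) g1M
  (fun i => xt i.+1) => g1x.
rewrite gxE (le_trans (ler_normD _ _))// [leRHS]mulrDl mul1r lerD ?gM// normrM.
apply: (@le_trans _ _ (K * (2 * M / d) * (rho * d))).
  by rewrite ler_pM// xt.
by rewrite le_eqVlt; apply/orP; left; apply/eqP; field; rewrite gt_eqF.
Qed.

(** A side of a cube with unspecified end points: squeezing it between the open and the closed
    interval treats all choices of faces at once. *)
Definition edge (R : realType) (a h : R) (A : set R) :=
  [/\ measurable A, `]a, a + h[%classic `<=` A & A `<=` `[a, a + h]%classic].

(** On each of s+1 separated subintervals, the minimum of |g| times the length is at most the
    integral. Interpolation at the s+1 minimizers then controls g on the whole closed interval. *)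
Lemma poly_le_average (R : realType) (s : nat) : exists2 K : R, 0 < K &
  forall (g : {poly R}) (a h x : R) (A : set R),
    (size g <= s.+1)%N -> 0 < h -> edge a h A -> a <= x <= a + h ->
    ((`|g.[x]| * h)%:E <=
       K%:E * \int[lebesgue_measure]_(y in A) (`|g.[y]|)%:E)%E.
Proof.
(* Of the 2s+3 pieces of length d = h/N, the subintervals are those numbered 1, 3, ..., 2s+1
   counting from 0. They are at distance at least d from each other, and they avoid both end points
   of the interval, so they lie in [A] whatever its faces. As h = N d, [N] is also the ratio [rho]
   of the interpolation lemma. *)
pose N : R := (2 * s + 3)%:R.
have N0 : 0 < N by rewrite ltr0n addn3.
have [K K0 KP] := @poly_le_separated R N s (ltW N0).
exists (K * N); first exact: mulr_gt0.
move=> g a h x A sg h0 [mA aA Aa] /andP[ax xh].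
pose I : \bar R := (\int[lebesgue_measure]_(y in A) (`|g.[y]|)%:E)%E.
rewrite -/I.
have cg : continuous (fun y : R => `|g.[y]| : R).
  by move=> y; apply: continuous_comp; [exact: continuous_horner|exact: norm_continuous].
have mg : measurable_fun [set: R] (EFin \o (fun y : R => `|g.[y]| : R)).
  by apply/measurable_EFinP; exact: continuous_measurable_fun.
have I0 : (0 <= I)%E by apply: integral_ge0 => y _; rewrite lee_fin.
have [Iy|] := eqVneq I +oo%E.
  by rewrite Iy gt0_muley ?leey// lte_fin mulr_gt0.
rewrite -ltey => Ifin.
have {}Ifin : I \is a fin_num by rewrite ge0_fin_numE.
pose d := h / N.
have d0 : 0 < d by rewrite divr_gt0.
have hE : h = d * N by rewrite divfK// gt_eqF.
pose l i := a + (2 * i + 1)%:R * d.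
have lS i : l i + d = a + (2 * i + 2)%:R * d by rewrite /l !natrD; ring.
(* The bound on [i] is placed under the existential so that [choice] gives a total sequence. *)
have tP i : exists t, (i <= s)%N ->
    [/\ l i <= t, t <= l i + d & ((`|g.[t]| * d)%:E <= I)%E].
  have [is_|] := leqP i s; last by exists 0.
  have lld : l i <= l i + d by rewrite lerDl ltW.
  have [|t] := @EVT_min R (fun y => `|g.[y]|) (l i) (l i + d) lld.
    exact: continuous_subspaceT.
  rewrite in_itv/= => /andP[lt tl] tmin; exists t => _; split => //.
  have subA : `[l i, l i + d]%classic `<=` A.
    apply: subset_trans aA => y /=; rewrite !in_itv/= => /andP[ly yl].
    apply/andP; split.
      by apply: lt_le_trans ly; rewrite ltrDl mulr_gt0// ltr0n addn1.
    apply: (le_lt_trans yl); rewrite lS hE ltrD2l mulrC ltr_pM2l// ltr_nat.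
    by rewrite (@leq_ltn_trans (2 * s + 2))// ?leq_add2r ?leq_mul2l// ltn_add2l.
  apply: (@le_trans _ _ (\int[lebesgue_measure]_(y in `[l i, (l i + d)%R]) (`|g.[t]|)%:E)%E).
    rewrite integral_cst//= lebesgue_measure_itv/= lte_fin ltrDl d0.
    by rewrite -EFinD -EFinM lee_fin addrAC subrr add0r.
  apply: (@le_trans _ _ (\int[lebesgue_measure]_(y in `[l i, (l i + d)%R]) (`|g.[y]|)%:E)%E).
    apply: ge0_le_integral => //.
    exact: (measurable_funS measurableT (@subsetT _ _) mg).
  apply: ge0_subset_integral => //.
  exact: (measurable_funS measurableT (@subsetT _ _) mg).
have [t {}tP] := choice tP.
have gt i : (i <= s)%N -> `|g.[t i]| <= fine I / d.
  by move=> /tP[_ _]; rewrite -{1}(fineK Ifin) lee_fin ler_pdivlMr.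
have := KP t d (fine I / d) g x d0 sg _ gt _.
rewrite -(fineK Ifin) -EFinM lee_fin => {}KP.
rewrite -ler_pdivlMr// hE (le_trans (KP _ _))//.
- move=> i j /andP[ij js]; have [lj _ _] := tP j js.
  have [_ il _] := tP i (leq_trans (ltnW ij) js).
  rewrite (le_trans _ (ler_norm _))// lerBrDl; apply: le_trans lj.
  apply: (@le_trans _ _ (l i + d + d)); first by rewrite lerD2r.
  rewrite /l (_ : _ + d + d = a + (2 * i + 3)%:R * d); last by rewrite !natrD; ring.
  rewrite lerD2l ler_pM2r// ler_nat.
  by rewrite (_ : (2 * i + 3)%N = (2 * i.+1 + 1)%N) ?leq_add2r ?leq_mul2l// mulnS addnC addnA addn1.
- move=> i is_; have [li il _] := tP i is_.
  have al : a <= t i by apply: le_trans li; rewrite lerDl mulr_ge0// ltW.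
  have lh : t i <= a + h.
    apply: (le_trans il); rewrite lS hE lerD2l mulrC ler_pM2l// ler_nat.
    by rewrite (@leq_trans (2 * s + 2))// ?leq_add2r ?leq_mul2l// leq_add2l.
  rewrite ler_norml; apply/andP; rewrite mulrC -hE; split; lra.
- rewrite le_eqVlt; apply/orP; left; apply/eqP; field.
  by rewrite !gt_eqF.
Qed.

Lemma lebesgue_measure_edge (R : realType) (a h : R) (A : set R) :
  0 < h -> edge a h A -> lebesgue_measure A = h%:E.
Proof.
move=> h0 [mA aA Aa].
have m : {in measurable &, {homo (@lebesgue_measure R) : X Y / X `<=` Y >-> (X <= Y)%E}}.
  exact: le_measure.
have itvE b1 b2 : lebesgue_measure [set` Interval (BSide b1 a) (BSide b2 (a + h))] = h%:E.
  rewrite lebesgue_measure_itv/= lte_fin ltrDl h0 -EFinD.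
  by rewrite addrAC subrr add0r.
apply/eqP; rewrite eq_le; apply/andP; split.
  rewrite -(itvE true false); apply: m; rewrite ?inE//.
rewrite -(itvE false true); apply: m; rewrite ?inE//.
Qed.

Definition box (R : realType) n (A : 'I_n -> set R) : set (n.-tuple R) :=
  [set x | forall i, A i (tnth x i)].

Lemma prod_EFin_cst (R : realType) n (h : R) : (\prod_(i < n) h%:E)%E = (h ^+ n)%:E.
Proof.
elim: n => [|n IH]; first by rewrite big_ord0 expr0.
by rewrite big_ord_recl IH -EFinM exprS.
Qed.

Lemma measure_box (R : realType) n (a : 'I_n -> R) (h : R) (A : 'I_n -> set R) :
  0 < h -> (forall i, edge (a i) h (A i)) ->
  lebesgue_measure_tuple n (box A) = (h ^+ n)%:E.
Proof.
move=> h0 eA; rewrite lebesgue_measure_tuple_box => [|i]; last by case: (eA i).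
under eq_bigr do rewrite (lebesgue_measure_edge h0 (eA _)).
exact: prod_EFin_cst.
Qed.

Lemma edge_itv (R : realType) b1 b2 (a h : R) :
  edge a h [set` Interval (BSide b1 a) (BSide b2 (a + h))].
Proof.
split; first exact: measurable_itv.
- apply/subitvP; rewrite subitvE; by case: b1 b2 => -[]; rewrite !bnd_simp ?lexx.
- apply/subitvP; rewrite subitvE; by case: b1 b2 => -[]; rewrite !bnd_simp ?lexx.
Qed.

(** Required by Tonelli's theorem; the space is exhausted by the centred cubes of side 2(k+1). *)
Lemma sigma_finite_lebesgue_measure_tuple (R : realType) n :
  sigma_finite setT (@lebesgue_measure_tuple R n).
Proof.
pose A k (i : 'I_n) : set R := `[- k.+1%:R, - k.+1%:R + 2 * k.+1%:R]%classic.
have h0 (k : nat) : 0 < 2 * k.+1%:R :> R by rewrite mulr_gt0// ltr0n.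
exists (fun k => box (A k)).
  apply/esym; rewrite -subTset => x _.
  pose M := \sum_(i < n) `|tnth x i|.
  have M0 : 0 <= M by apply: sumr_ge0.
  exists (Num.bound M) => // i; rewrite /A/= in_itv/=.
  have xM : `|tnth x i| <= M by rewrite /M (bigD1 i)//= lerDl sumr_ge0.
  have Mk : M < (Num.bound M)%:R by have := archi_boundP M0.
  have kS : (Num.bound M)%:R <= (Num.bound M).+1%:R :> R by rewrite ler_nat.
  by move: xM; rewrite ler_norml => /andP[? ?]; apply/andP; split; lra.
move=> k; split; first by apply: measurable_tuple_box => i; exact: measurable_itv.
by rewrite (measure_box (h0 k) (fun i => edge_itv true false _ _)) ltry.
Qed.

(* [lebesgue_measure_tuple] returns a packed measure, on which a structure cannot
   be declared; this is its underlying function. *)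
Definition lebesgue_tuple (R : realType) n : set (n.-tuple R) -> \bar R :=
  lebesgue_measure_tuple n.

HB.instance Definition _ (R : realType) n :=
  isMeasure.Build _ _ _ (@lebesgue_tuple R n)
    (measure0 (lebesgue_measure_tuple n)) (measure_ge0 (lebesgue_measure_tuple n))
    (@measure_semi_sigma_additive _ _ _ (lebesgue_measure_tuple n)).

HB.instance Definition _ (R : realType) n :=
  Measure_isSigmaFinite.Build _ _ _ (@lebesgue_tuple R n)
    (@sigma_finite_lebesgue_measure_tuple R n).

Definition mpolyfun (R : realType) (I : Type) n (r : seq I) (c : I -> R)
    (e : I -> 'I_n -> nat) (x : n.-tuple R) : R :=
  \sum_(m <- r) c m * \prod_(i < n) tnth x i ^+ e m i.

Lemma measurable_mpolyfun (R : realType) (I : Type) n (r : seq I) (c : I -> R)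
    (e : I -> 'I_n -> nat) : measurable_fun setT (mpolyfun r c e).
Proof.
apply: measurable_sum => m; apply: measurable_funM => //.
apply: measurable_prod => i _; apply: measurable_funX.
exact: measurable_tnth.
Qed.

Lemma measurable_abs_mpolyfun (R : realType) (I : Type) n (r : seq I) (c : I -> R)
    (e : I -> 'I_n -> nat) :
  measurable_fun setT (fun x => (`|mpolyfun r c e x|)%:E).
Proof.
by apply/measurable_EFinP; apply: measurableT_comp => //; exact: measurable_mpolyfun.
Qed.

Lemma mpolyfun_cons (R : realType) (I : Type) n (r : seq I) (c : I -> R)
    (e : I -> 'I_n.+1 -> nat) (x : n.-tuple R) (t : R) :
  mpolyfun r c e (Defs.cons_tuple (x, t)) =
  mpolyfun r (fun m => c m * t ^+ e m ord0) (fun m i => e m (lift ord0 i)) x.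
Proof.
apply: eq_bigr => m _; rewrite big_ord_recl tnth0/= mulrA; congr (_ * _).
by apply: eq_bigr => i _; rewrite tnthS.
Qed.

Lemma mpolyfun_cons_poly (R : realType) (I : Type) n (r : seq I) (c : I -> R)
    (e : I -> 'I_n.+1 -> nat) (s : nat) (x : n.-tuple R) :
  (forall m i, e m i <= s)%N ->
  exists2 g : {poly R}, (size g <= s.+1)%N &
    forall t, mpolyfun r c e (Defs.cons_tuple (x, t)) = g.[t].
Proof.
move=> es.
exists (\sum_(m <- r) (c m * \prod_(i < n) tnth x i ^+ e m (lift ord0 i)) *: 'X^(e m ord0)).
  apply: (leq_trans (size_sum _ _ _)).
  apply: (big_ind (fun k => (k <= s.+1)%N)) => [//|k l ks ls|m _].
    by rewrite geq_max ks.
  by rewrite (leq_trans (size_scale_leq _ _))// size_polyXn ltnS.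
move=> t; rewrite mpolyfun_cons horner_sum; apply: eq_bigr => m _.
by rewrite hornerZ hornerXn mulrAC.
Qed.

(** Tonelli's theorem with the first coordinate as the inner variable. Measurability of the inner
    integral is part of the conclusion because the induction on the dimension has to scale and
    compare it. *)
Lemma ge0_integral_box_cons (R : realType) n (A : 'I_n.+1 -> set R)
    (f : n.+1.-tuple R -> \bar R) :
  (forall i, measurable (A i)) -> measurable_fun setT f ->
  (forall x, 0 <= f x)%E ->
  measurable_fun setT
    (fun x => \int[lebesgue_measure]_(t in A ord0) f (Defs.cons_tuple (x, t)))%E /\
  (\int[lebesgue_measure_tuple n.+1]_(x in box A) f x =
   \int[lebesgue_measure_tuple n]_(x in box (fun i => A (lift ord0 i)))
     \int[lebesgue_measure]_(t in A ord0) f (Defs.cons_tuple (x, t)))%E.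
Proof.
move=> mA mf f0.
have mbox m (B : 'I_m -> set R) : (forall i, measurable (B i)) -> measurable (box B).
  exact: measurable_tuple_box.
set B := box (fun i => A (lift ord0 i)).
have mB : measurable B by exact: mbox.
pose g := f \_ (box A) \o @Defs.cons_tuple R n.
have mg : measurable_fun setT g.
  apply: measurableT_comp; last exact: measurable_cons_tuple.
  by apply/(measurable_restrictT _ (mbox _ _ mA)); exact: measurable_funTS.
have g0 z : (0 <= g z)%E by rewrite /g /= patchE; case: ifPn.
have boxE x t : box A (Defs.cons_tuple (x, t)) <-> B x /\ A ord0 t.
  split=> [xA|[xB At] i].
    by split=> [i|]; [have := xA (lift ord0 i); rewrite tnthS
                     |have := xA ord0; rewrite tnth0].
  by have [j ->|->] := unliftP ord0 i; rewrite ?tnthS ?tnth0//; exact: xB.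
split.
  (* Restricting the first coordinate only, and not the others to [B], gives measurability of the
     inner integral on the whole space. *)
  pose h := (f \o @Defs.cons_tuple R n) \_ (setT `*` A ord0).
  have mh : measurable_fun setT h.
    have mS : measurable ([set: n.-tuple R] `*` (A ord0 : set (measurableTypeR R))).
      by apply: measurableX => //; exact: (mA ord0).
    apply/(measurable_restrictT _ mS).
    apply: (measurable_funS measurableT (@subsetT _ _)).
    by apply: (measurableT_comp mf); exact: measurable_cons_tuple.
  have h0 z : (0 <= h z)%E by rewrite /h patchE; case: ifPn => //= _; exact: f0.
  have := @measurable_fun_fubini_tonelli_F _ _ _ _ R (@lebesgue_measure R) h mh h0.
  apply: eq_measurable_fun => x _; rewrite /fubini_F [RHS]integral_mkcond.
  apply: eq_integral => t _; rewrite /h !patchE.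
  by rewrite in_setX in_setT.
rewrite integral_mkcond /=.
rewrite [LHS](_ : _ = \int[lebesgue_measure_tuple n \x lebesgue_measure]_z g z)%E; last first.
  rewrite (ge0_integral_pushforward (@measurable_cons_tuple R n))//.
  - by apply/(measurable_restrictT _ (mbox _ _ mA)); exact: measurable_funTS.
  - by move=> y _; rewrite patchE; case: ifPn.
rewrite (@fubini_tonelli1 _ _ _ _ R (@lebesgue_tuple R n) (@lebesgue_measure R) g mg g0).
rewrite [RHS]integral_mkcond; apply: eq_integral => x _.
rewrite /fubini_F patchE; case: ifPn => xB.
  rewrite [RHS]integral_mkcond; apply: eq_integral => t _.
  rewrite /g/= !patchE; congr (if _ then _ else _); apply/idP/idP; rewrite !inE.
    by move=> /boxE[].
  by move=> At; apply/boxE; split => //; exact: set_mem.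
apply: integral0_eq => t _; rewrite /g/= patchE; case: ifPn => //.
by rewrite inE => /boxE[/mem_set]; rewrite (negbTE xB).
Qed.

(** Induction on the dimension: the first coordinate is frozen at its value in [x], the induction
    hypothesis bounds the slice, and the one-dimensional bound is applied under the integral.
    Degrees are bounded in each variable separately, a condition inherited by the slices. *)
Lemma mpolyfun_le_average (R : realType) (s : nat) : exists2 K : R, 0 < K &
  forall n (I : Type) (r : seq I) (c : I -> R) (e : I -> 'I_n -> nat)
      (a : 'I_n -> R) (h : R) (A : 'I_n -> set R) (x : n.-tuple R),
    (forall m i, e m i <= s)%N -> 0 < h -> (forall i, edge (a i) h (A i)) ->
    (forall i, a i <= tnth x i <= a i + h) ->
    ((`|mpolyfun r c e x| * h ^+ n)%:E <=
      (K ^+ n)%:E * \int[lebesgue_measure_tuple n]_(y in box A) (`|mpolyfun r c e y|)%:E)%E.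
Proof.
have [K K0 KP] := poly_le_average R s; exists K => //.
elim=> [|n IH] I r c e a h A x es h0 eA xA.
  rewrite !expr0 mul1e mulr1 (_ : box A = setT); last by apply/seteqP; split=> // y _ [].
  rewrite integral_dirac//; last exact: measurable_abs_mpolyfun.
  by rewrite diracE in_setT mul1e (tuple0 x).
have mF := measurable_abs_mpolyfun r c e.
have F0 y : (0 <= (`|mpolyfun r c e y|)%:E)%E by rewrite lee_fin.
have mA i : measurable (A i) by case: (eA i).
have [mI ->] := ge0_integral_box_cons mA mF F0.
set B := box _.
have mB : measurable B by exact: measurable_tuple_box.
have [t [x' xE]] : exists t x', x = Defs.cons_tuple (x', t).
  exists (thead x), (behead_tuple x); rewrite {1}(tuple_eta x).
  exact: val_inj.
have x'A i : a (lift ord0 i) <= tnth x' i <= a (lift ord0 i) + h.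
  by have := xA (lift ord0 i); rewrite xE tnthS.
have tA : a ord0 <= t <= a ord0 + h by have := xA ord0; rewrite xE tnth0.
pose c' m := c m * t ^+ e m ord0.
pose e' m i := e m (lift ord0 i).
have {}IH := IH I r c' e' _ h _ x' (fun m i => es m _) h0 (fun i => eA (lift ord0 i)) x'A.
have mF' := measurable_abs_mpolyfun r c' e'.
rewrite xE mpolyfun_cons exprS mulrCA EFinM.
apply: (@le_trans _ _ (h%:E * ((K ^+ n)%:E *
    \int[lebesgue_measure_tuple n]_(y in B) (`|mpolyfun r c' e' y|)%:E))%E).
  by rewrite lee_pmul2l// lte_fin.
rewrite muleCA exprSr EFinM -muleA lee_pmul2l//; last by rewrite lte_fin exprn_gt0.
rewrite -ge0_integralZl//; last 2 first.
- exact: (measurable_funS measurableT (@subsetT _ _) mF').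
- by rewrite lee_fin ltW.
rewrite -ge0_integralZl//; last 3 first.
- exact: (measurable_funS measurableT (@subsetT _ _) mI).
- by move=> y _; apply: integral_ge0 => u _; rewrite lee_fin.
- by rewrite lee_fin ltW.
apply: ge0_le_integral => //.
- by move=> y _; rewrite -EFinM lee_fin mulr_ge0// ltW.
- by apply: measurable_funTS; exact: measurable_funeM.
- by apply: measurable_funTS; exact: measurable_funeM.
move=> y _; have [g sg gE] := mpolyfun_cons_poly r c y es.
rewrite /c' /e' -mpolyfun_cons gE muleC -EFinM.
under eq_integral do rewrite gE.
exact: KP sg h0 (eA _) tA.
Qed.

(** * Jensen inequality for power means *)

Lemma lee_poweR (R : realType) (r : R) (x y : \bar R) :
  0 <= r -> (0 <= x)%E -> (x <= y)%E -> (x `^ r <= y `^ r)%E.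
Proof.
move=> r0 x0 xy; apply: gt0_ler_poweR => //; rewrite in_itv/= leey andbT//.
exact: le_trans xy.
Qed.

Lemma poweRK (R : realType) (r : R) (x : \bar R) :
  r != 0 -> (0 <= x)%E -> ((x `^ r) `^ r^-1 = x)%E.
Proof. by move=> r0 x0; rewrite -poweRrM divff// poweRe1. Qed.

Lemma poweRVK (R : realType) (r : R) (x : \bar R) :
  r != 0 -> (0 <= x)%E -> ((x `^ r^-1) `^ r = x)%E.
Proof. by move=> r0 x0; rewrite -poweRrM mulVf// poweRe1. Qed.

Section power_mean.
Context d (T : measurableType d) (R : realType) (mu : {measure set T -> \bar R}).
Local Open Scope ereal_scope.

(** Hölder's inequality for [g] and the constant 1 on [A], with the exponent [r] and its
    conjugate. *)
Lemma power_mean (A : set T) (v r : R) (g : T -> R) :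
  measurable A -> mu A = v%:E -> (0 < v)%R -> (1 <= r)%R ->
  measurable_fun A g -> (forall x, A x -> 0 <= g x)%R ->
  v^-1%:E * \int[mu]_(x in A) (g x)%:E <=
    (v^-1%:E * \int[mu]_(x in A) (g x `^ r)%:E) `^ r^-1.
Proof.
move=> mA muA v0; have v10 : (0 <= v^-1)%R by rewrite invr_ge0 ltW.
have I0 (h : T -> R) : (forall x, A x -> 0 <= h x)%R -> 0 <= \int[mu]_(x in A) (h x)%:E.
  by move=> h0; apply: integral_ge0 => x Ax; rewrite lee_fin h0.
(* For [r = 1] the conjugate exponent is infinite, but then both sides agree. *)
rewrite le_eqVlt => /predU1P[<- mg g0|r1 mg g0].
  rewrite invr1 poweRe1 ?mule_ge0 ?I0 ?lee_fin// => [|x Ax]; last exact: powR_ge0.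
  rewrite le_eqVlt; apply/orP; left; apply/eqP; congr *%E.
  by apply: eq_integral => x /set_mem Ax; rewrite powRr1// g0.
have r0 : (0 < r)%R by rewrite (lt_trans _ r1).
pose r' := (1 - r^-1)^-1%R.
have r1' : (0 < 1 - r^-1)%R by rewrite subr_gt0 invf_lt1.
have r'0 : (0 < r')%R by rewrite invr_gt0.
have rr' : (r^-1 + r'^-1 = 1)%R by rewrite invrK subrKC.
pose G := g \_ A; pose J : T -> R := \1_A.
have mG : measurable_fun setT G by apply/(measurable_restrictT _ mA).
have mJ : measurable_fun setT J by exact: measurable_indic.
have H := hoelder mu mG mJ r0 r'0 rr'.
have E1 : 'N[mu]_1[EFin \o (G \* J)%R] = \int[mu]_(x in A) (g x)%:E.
  rewrite Lnorm1 [RHS]integral_mkcond; apply: eq_integral => x _.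
  rewrite /= /G /J !patchE indicE; case: ifPn => [/set_mem Ax|_].
    by rewrite mulr1 ger0_norm// g0.
  by rewrite mulr0 normr0.
have E2 : 'N[mu]_r%:E[EFin \o G] = (\int[mu]_(x in A) (g x `^ r)%:E) `^ r^-1.
  rewrite unlock /Lnorm [in RHS]integral_mkcond; congr (_ `^ _).
  apply: eq_integral => x _; rewrite /= /G !patchE.
  case: ifPn => [/set_mem Ax|_]; first by rewrite ger0_norm// g0.
  by rewrite normr0 powR0// gt_eqF.
have E3 : 'N[mu]_r'%:E[EFin \o J] = (v `^ (1 - r^-1))%:E.
  rewrite unlock /Lnorm invrK -poweR_EFin; congr (_ `^ _).
  rewrite -muA -[in RHS](setIT A) -integral_indic//.
  apply: eq_integral => x _ /=; rewrite /J indicE.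
  by case: (x \in A); rewrite ?normr1 ?powR1// normr0 powR0// gt_eqF.
rewrite E1 E2 E3 in H.
have v1e : 0 <= v^-1%:E by rewrite lee_fin.
have := lee_wpmul2l v1e H.
move/le_trans; apply.
rewrite poweRM//; last by apply: I0 => x _; exact: powR_ge0.
rewrite muleCA muleC -EFinM poweR_EFin le_eqVlt; apply/orP; left.
apply/eqP; congr (_%:E * _).
rewrite -(powR_inv1 (ltW v0)) -powRD; last by rewrite (gt_eqF v0) implybT.
by rewrite -powRrM; congr (_ `^ _)%R; rewrite mulN1r addrA addNr add0r.
Qed.

End power_mean.

(** * Oscillations on cubes *)

Section cubes.
Context {R : realType} {n : nat}.
Local Notation T := (n.-tuple R).
Local Notation mu := (@lebesgue_measure_tuple R n).

Definition cube_vol (Q : cube R n) : R := cube_side Q ^+ n.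

Lemma cube_vol_gt0 Q : 0 < cube_vol Q.
Proof. by rewrite exprn_gt0// cube_side_gt0. Qed.

Lemma cube_edge (Q : cube R n) i : edge (tnth (cube_corner Q) i) (cube_side Q)
  [set` Interval (BSide (cube_lbound Q i) (tnth (cube_corner Q) i))
    (BSide (cube_rbound Q i) (tnth (cube_corner Q) i + cube_side Q))].
Proof. exact: edge_itv. Qed.

Lemma measurable_cube (Q : cube R n) : measurable (cube_set Q).
Proof. exact: (measurable_tuple_box (fun i => measurable_itv _)). Qed.

Lemma measure_cube (Q : cube R n) : mu (cube_set Q) = (cube_vol Q)%:E.
Proof. exact: (measure_box (cube_side_gt0 Q) (cube_edge Q)). Qed.

(** The polynomial bounds hold up to the boundary. This is used for open grid cells, since a point
    of the space may lie only in the closure of its cell. *)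
Definition in_closed_cube (Q : cube R n) (x : T) :=
  forall i, tnth (cube_corner Q) i <= tnth x i <= tnth (cube_corner Q) i + cube_side Q.

Lemma cube_set_closed (Q : cube R n) x : cube_set Q x -> in_closed_cube Q x.
Proof.
move=> Qx i; have [_ _ /(_ (tnth x i))/=] := cube_edge Q i.
by rewrite in_itv/=; apply; exact: Qx.
Qed.

Lemma poly_evalE (s : nat) (P : mpoly n R) : (msize P <= s.+1)%N ->
  exists (c : multinom n -> R) (e : multinom n -> 'I_n -> nat),
    (forall m i, e m i <= s)%N /\
    poly_eval P = mpolyfun (msupp P) c e.
Proof.
move=> sP; exists (fun m => mcoeff m P), (fun m i => minn (m i) s); split.
  by move=> m i; exact: geq_minr.
apply/funext => x; rewrite /poly_eval mevalE /mpolyfun.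
  apply: eq_big_seq => m mP; rewrite /=.
congr (_ * _); apply: eq_bigr => i _; congr (_ ^+ _).
apply/esym/minn_idPl; rewrite -ltnS (leq_trans _ sP)//.
apply: leq_ltn_trans (msize_mdeg_lt mP).
by rewrite mdegE (bigD1 i)//= leq_addr.
Qed.

Lemma measurable_poly_eval (P : mpoly n R) : measurable_fun setT (@poly_eval R n P).
Proof.
by have [c [e [_ ->]]] := poly_evalE (leqnSn (msize P)); exact: measurable_mpolyfun.
Qed.

Lemma poly_eval_bounded (Q : cube R n) (P : mpoly n R) :
  exists2 M : R, 0 < M & forall x, in_closed_cube Q x -> `|poly_eval P x| <= M.
Proof.
have [c [e [_ ->]]] := poly_evalE (leqnSn (msize P)).
pose B := 1 + \sum_(i < n) (`|tnth (cube_corner Q) i| + cube_side Q).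
have s0 := ltW (cube_side_gt0 Q).
have B1 : 1 <= B by rewrite lerDl sumr_ge0// => i _; rewrite addr_ge0.
exists (1 + \sum_(m <- msupp P) `|c m| * \prod_(i < n) B ^+ e m i).
  rewrite ltr_pwDl// sumr_ge0// => m _; rewrite mulr_ge0// prodr_ge0// => i _.
  by rewrite exprn_ge0// (le_trans ler01 B1).
move=> x Qx; rewrite (le_trans (ler_norm_sum _ _ _))//.
apply: ler_wpDl => //; apply: ler_sum => m _; rewrite normrM ler_wpM2l//.
rewrite normr_prod; apply: ler_prod => i _; rewrite normr_ge0/= normrX.
apply: lerXn2r; rewrite ?nnegrE ?(le_trans ler01 B1)//.
have := Qx i; rewrite /B (bigD1 i)//=.
set S := \sum_(_ < _ | _) _; have : 0 <= S by rewrite sumr_ge0// => j _; rewrite addr_ge0.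
have := ler_norm (tnth (cube_corner Q) i); have := ler_norm (- tnth (cube_corner Q) i).
rewrite normrN => ? ? ? /andP[? ?]; rewrite ler_norml; apply/andP; split; lra.
Qed.

Definition osc (q : R) (Q : cube R n) (f : T -> R) (P : mpoly n R) : \bar R :=
  (mean_oscillation q Q f P `^ q^-1)%E.

Lemma mean_oscillationE (q : R) (Q : cube R n) f P :
  mean_oscillation q Q f P = ((cube_vol Q)^-1%:E *
    \int[mu]_(x in cube_set Q) (`|f x - poly_eval P x| `^ q)%:E)%E.
Proof. by rewrite /mean_oscillation measure_cube inver gt_eqF// cube_vol_gt0. Qed.

Lemma mean_oscillation_ge0 (q : R) (Q : cube R n) f P :
  (0 <= mean_oscillation q Q f P)%E.
Proof.
rewrite mean_oscillationE; apply: mule_ge0.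
  by rewrite lee_fin invr_ge0 ltW// cube_vol_gt0.
by apply: integral_ge0 => x _; rewrite lee_fin powR_ge0.
Qed.

Lemma osc_ge0 (q : R) (Q : cube R n) f P : (0 <= osc q Q f P)%E.
Proof. exact: poweR_ge0. Qed.

Lemma jn_summandE (p q alpha : R) (Q : cube R n) f P :
  jn_summand p q alpha Q f P =
    ((cube_vol Q `^ (1 - alpha * p))%:E * osc q Q f P `^ p)%E.
Proof.
rewrite /jn_summand measure_cube; have v0 := cube_vol_gt0 Q.
rewrite poweRM ?poweR_ge0//; rewrite muleA -poweRrM; congr (_ * _)%E.
rewrite poweR_EFin -EFinM; congr _%:E.
by rewrite -{1}(powRr1 (ltW v0)) -powRD ?mulNr// (gt_eqF v0) implybT.
Qed.

Lemma jn_summand_ge0 (p q alpha : R) (Q : cube R n) f P :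
  (0 <= jn_summand p q alpha Q f P)%E.
Proof. by rewrite jn_summandE mule_ge0// ?lee_fin ?powR_ge0 ?poweR_ge0. Qed.

Lemma le_jn_summand (p q alpha C : R) (Q : cube R n) f P1 P2 :
  0 <= p -> 0 <= C -> (osc q Q f P1 <= C%:E * osc q Q f P2)%E ->
  (jn_summand p q alpha Q f P1 <= (C `^ p)%:E * jn_summand p q alpha Q f P2)%E.
Proof.
move=> p0 C0 o12; rewrite !jn_summandE muleCA lee_wpmul2l ?lee_fin ?powR_ge0//.
by rewrite -poweR_EFin -poweRM ?osc_ge0// lee_poweR// osc_ge0.
Qed.

Lemma measurable_diff_poly (Q : cube R n) (f : T -> R) P :
  measurable_fun (cube_set Q) f ->
  measurable_fun (cube_set Q) (fun x => f x - poly_eval P x).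
Proof.
by move=> mf; apply: measurable_funB => //; apply: measurable_funTS; exact: measurable_poly_eval.
Qed.

Lemma measurable_abs_diff_poly (Q : cube R n) (f : T -> R) P :
  measurable_fun (cube_set Q) f ->
  measurable_fun (cube_set Q) (fun x => `|f x - poly_eval P x|).
Proof. by move=> mf; apply: measurableT_comp => //; exact: measurable_diff_poly. Qed.

Lemma average_le_osc (q : R) (Q : cube R n) (f : T -> R) P :
  1 <= q -> measurable_fun (cube_set Q) f ->
  ((cube_vol Q)^-1%:E * \int[mu]_(x in cube_set Q) (`|f x - poly_eval P x|)%:E
    <= osc q Q f P)%E.
Proof.
move=> q1 mf; rewrite /osc mean_oscillationE.
apply: (power_mean _ (measure_cube Q) (cube_vol_gt0 Q) q1) => //.
- exact: measurable_cube.
- exact: measurable_abs_diff_poly.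
Qed.

Lemma poly_eval_le_average (s : nat) : exists2 K : R, 0 < K &
  forall (Q : cube R n) P x, (msize P <= s.+1)%N -> in_closed_cube Q x ->
  ((`|poly_eval P x|)%:E <= K%:E * ((cube_vol Q)^-1%:E *
      \int[mu]_(y in cube_set Q) (`|poly_eval P y|)%:E))%E.
Proof.
have [K K0 KP] := mpolyfun_le_average R s; exists (K ^+ n); first exact: exprn_gt0.
move=> Q P x sP Qx; have [c [e [es ->]]] := poly_evalE sP.
rewrite muleCA -lee_pdivrMl ?invr_gt0 ?cube_vol_gt0// invrK -EFinM mulrC.
exact: KP es (cube_side_gt0 Q) (cube_edge Q) Qx.
Qed.

Lemma poly_diff_le_osc (s : nat) : exists2 K : R, 0 < K &
  forall (q : R) (Q' Q : cube R n) f P' P x, 1 <= q ->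
  cube_set Q' `<=` cube_set Q -> cube_side Q = 2 * cube_side Q' ->
  (msize P' <= s.+1)%N -> (msize P <= s.+1)%N -> measurable_fun (cube_set Q) f ->
  in_closed_cube Q' x ->
  ((`|poly_eval P' x - poly_eval P x|)%:E <=
     K%:E * (osc q Q' f P' + osc q Q f P))%E.
Proof.
have [K K0 KP] := poly_eval_le_average s; exists (K * 2 ^+ n).
  by rewrite mulr_gt0// exprn_gt0.
move=> q Q' Q f P' P x q1 QQ sQ sP' sP mf Qx.
have mQ' := measurable_cube Q'; have mQ := measurable_cube Q.
have mf' : measurable_fun (cube_set Q') f by exact: measurable_funS mf.
have sD : (msize (P' - P) <= s.+1)%N.
  by rewrite (leq_trans (msizeD_le _ _))// geq_max sP' msizeN.
have DE y : poly_eval P' y - poly_eval P y = poly_eval (P' - P) y.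
  by rewrite /poly_eval mevalB.
rewrite DE; apply: (le_trans (KP Q' _ x sD Qx)).
rewrite EFinM -muleA lee_pmul2l ?lte_fin//.
have v'0 := cube_vol_gt0 Q'; have v0 := cube_vol_gt0 Q.
have volE : cube_vol Q = 2 ^+ n * cube_vol Q' by rewrite /cube_vol sQ exprMn.
have iv'0 : (0 <= (cube_vol Q')^-1%:E)%E by rewrite lee_fin invr_ge0 ltW.
have osc_mean := average_le_osc _ q1.
apply: (@le_trans _ _ ((cube_vol Q')^-1%:E *
    (\int[mu]_(y in cube_set Q') (`|f y - poly_eval P' y|)%:E +
     \int[mu]_(y in cube_set Q) (`|f y - poly_eval P y|)%:E))%E).
  apply: lee_wpmul2l => //.
  apply: (@le_trans _ _ (\int[mu]_(y in cube_set Q')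
     ((`|f y - poly_eval P' y|)%:E + (`|f y - poly_eval P y|)%:E))%E).
    apply: ge0_le_integral => //.
    - by apply/measurable_EFinP; apply: measurableT_comp => //;
        apply: measurable_funTS; exact: measurable_poly_eval.
    - by apply: emeasurable_funD; apply/measurable_EFinP; exact: measurable_abs_diff_poly.
    - move=> y _; rewrite -EFinD lee_fin -DE.
      rewrite (_ : _ - _ = (f y - poly_eval P y) - (f y - poly_eval P' y)); last by ring.
      by rewrite [leRHS]addrC ler_normB.
  rewrite ge0_integralD//; last 2 first.
  - by apply/measurable_EFinP; exact: measurable_abs_diff_poly.
  - by apply/measurable_EFinP; exact: measurable_abs_diff_poly.
  apply: leeD => //; apply: ge0_subset_integral => //.
  by apply/measurable_EFinP; exact: measurable_abs_diff_poly.
rewrite [leRHS]ge0_muleDr ?osc_ge0//.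
rewrite [leLHS]ge0_muleDr ?integral_ge0//; apply: leeD.
  apply: (le_trans (osc_mean _ _ _ mf')).
  by rewrite lee_pemull ?osc_ge0// lee_fin exprn_ege1// ler1n.
apply: (@le_trans _ _ ((2 ^+ n)%:E * ((cube_vol Q)^-1%:E *
   \int[mu]_(y in cube_set Q) (`|f y - poly_eval P y|)%:E))%E).
  rewrite volE muleA -EFinM invfM mulrA divff ?mul1r// gt_eqF// exprn_gt0//.
apply: lee_wpmul2l; last exact: osc_mean.
by rewrite lee_fin exprn_ge0.
Qed.

End cubes.

(** * Orthogonal projection onto polynomials on a cube *)

Section projection.
Context {R : realType} {n : nat}.
Local Notation T := (n.-tuple R).
Local Notation mu := (@lebesgue_measure_tuple R n).

Lemma poly_eval0 (x : T) : poly_eval 0 x = 0.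
Proof. exact: meval0. Qed.

Lemma integrable_mul_poly (Q : cube R n) (g : T -> R) P :
  mu.-integrable (cube_set Q) (EFin \o g) ->
  mu.-integrable (cube_set Q) (fun x => (g x * poly_eval P x)%:E).
Proof.
move=> ig; apply: (@eq_integrable _ _ _ mu _ (measurable_cube Q)
  ((EFin \o g) \* (EFin \o poly_eval P))%E) => [x _ //|].
apply: integrableMl => //; first exact: measurable_cube.
  by apply: measurable_funTS; exact: measurable_poly_eval.
have [M M0 MP] := poly_eval_bounded Q P.
exists M; split; first exact: num_real.
by move=> y My x Qx; apply: (le_trans (MP _ _) (ltW My)); exact: cube_set_closed.
Qed.

Lemma integrable_poly (Q : cube R n) P :
  mu.-integrable (cube_set Q) (EFin \o poly_eval P).
Proof.
have i1 : mu.-integrable (cube_set Q) (EFin \o (fun=> 1%R : R)).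
  apply: measurable_bounded_integrable; first exact: measurable_cube.
  - by have /= -> := measure_cube Q; rewrite ltry.
  - exact: measurable_cst.
  - exists 1; split; first exact: num_real.
    by move=> y y1 x _ /=; rewrite normr1 ltW.
apply: eq_integrable (integrable_mul_poly P i1); first exact: measurable_cube.
by move=> x _ /=; rewrite mul1r.
Qed.

(** The residual is orthogonal to every monomial of degree at most [s], hence by linearity to the
    projection itself. *)
Lemma poly_proj_orthogonal (s : nat) (Q : cube R n) (f : T -> R) P :
  is_poly_proj s Q f P -> mu.-integrable (cube_set Q) (EFin \o f) ->
  (\int[mu]_(x in cube_set Q) ((f x - poly_eval P x) * poly_eval P x)%:E = 0)%E.
Proof.
move=> [sP orth] int_f; have mQ := measurable_cube Q.
pose g x := f x - poly_eval P x.
have ig : mu.-integrable (cube_set Q) (EFin \o g).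
  apply: eq_integrable (integrableB mQ int_f (integrable_poly Q P)) => //.
pose mon (m : multinom n) (x : T) := \prod_(i < n) tnth x i ^+ m i.
have monE m x : mon m x = poly_eval (mpolyX R m) x by rewrite /poly_eval mevalX.
have imon m : mu.-integrable (cube_set Q) (fun x => (g x * mon m x)%:E).
  apply: eq_integrable (integrable_mul_poly (mpolyX R m) ig) => // x _.
  by rewrite monE.
(* Linearity by induction on sublists of the support; integrability is carried along because
   additivity of the integral needs it. *)
have main (r : seq (multinom n)) : {subset r <= msupp P} ->
    mu.-integrable (cube_set Q) (fun x => (g x * \sum_(m <- r) mcoeff m P * mon m x)%:E) /\
    (\int[mu]_(x in cube_set Q) (g x * \sum_(m <- r) mcoeff m P * mon m x)%:E = 0)%E.
  elim: r => [|m r IH] sub_r.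
    under eq_fun do rewrite big_nil mulr0.
    by split; [exact: integrable0|rewrite integral0].
  have [m' m'r|i1 e1] := IH; first by apply: sub_r; rewrite inE m'r orbT.
  have i2 : mu.-integrable (cube_set Q)
      (fun x => (mcoeff m P)%:E * (g x * mon m x)%:E)%E by exact: integrableZl.
  have E x : ((g x * \sum_(m' <- m :: r) mcoeff m' P * mon m' x)%:E =
      (mcoeff m P)%:E * (g x * mon m x)%:E +
      (g x * \sum_(m <- r) mcoeff m P * mon m x)%:E)%E.
    by rewrite big_cons mulrDr EFinD mulrCA -EFinM.
  rewrite (funext E); split; first exact: integrableD.
  rewrite integralD// e1 adde0 integralZl//.
  rewrite [X in (_ * X)%E](_ : _ = 0)%E ?mule0//; apply: orth.
  rewrite -mdegE -ltnS (leq_trans _ sP)// msize_mdeg_lt//.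
  by apply: sub_r; rewrite mem_head.
by have [_ <-] := main (msupp P) (fun _ => id).
Qed.

Lemma poly_proj_bound (s : nat) : exists2 K : R, 0 < K &
  forall (Q : cube R n) (f : T -> R) P x, is_poly_proj s Q f P ->
    mu.-integrable (cube_set Q) (EFin \o f) -> cube_set Q x ->
    ((`|poly_eval P x|)%:E <= K%:E * ((cube_vol Q)^-1%:E *
       \int[mu]_(y in cube_set Q) (`|f y|)%:E))%E.
Proof.
(* With m and a the averages of |P| and |f|: |P| <= K m, and
   m^2 <= avg P^2 = avg (f P) <= K m a by orthogonality, so m <= K a. *)
have [K K0 KP] := @poly_eval_le_average R n s; exists (K * K); first exact: mulr_gt0.
move=> Q f P x projP int_f Qx; have [sP _] := projP.
have v0 := cube_vol_gt0 Q; have iv0 : 0 <= (cube_vol Q)^-1 by rewrite invr_ge0 ltW.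
have mQ := measurable_cube Q; have int_P := integrable_poly Q P.
have [/measurable_EFinP mf _] := integrableP _ _ _ int_f.
have mP : measurable_fun (cube_set Q) (poly_eval P).
  by apply: measurable_funTS; exact: measurable_poly_eval.
have mnP : measurable_fun (cube_set Q) (fun y => `|poly_eval P y|).
  exact: measurableT_comp.
have avgE (g : T -> R) : mu.-integrable (cube_set Q) (EFin \o g) ->
    exists2 a, 0 <= a & ((cube_vol Q)^-1%:E * \int[mu]_(y in cube_set Q) (`|g y|)%:E = a%:E)%E.
  move=> /integrableP[_ fin].
  have I0 : (0 <= \int[mu]_(y in cube_set Q) (`|g y|)%:E)%E.
    by apply: integral_ge0 => y _; rewrite lee_fin.
  rewrite -[X in (_ * X)%E]fineK; last by rewrite ge0_fin_numE.
  by exists ((cube_vol Q)^-1 * fine (\int[mu]_(y in cube_set Q) (`|g y|)%:E)%E);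
    rewrite ?EFinM// mulr_ge0// fine_ge0.
have [a a0 aE] := avgE _ int_f.
have [m m0 mE] := avgE _ int_P.
have Pm y : cube_set Q y -> `|poly_eval P y| <= K * m.
  by move=> Qy; rewrite -lee_fin EFinM -mE; apply: KP => //; exact: cube_set_closed.
rewrite aE -EFinM lee_fin.
have iPP : mu.-integrable (cube_set Q) (fun y => (poly_eval P y * poly_eval P y)%:E).
  exact: integrable_mul_poly.
have ifP : mu.-integrable (cube_set Q) (fun y => (f y * poly_eval P y)%:E).
  exact: integrable_mul_poly.
have sqE : (\int[mu]_(y in cube_set Q) (poly_eval P y * poly_eval P y)%:E =
            \int[mu]_(y in cube_set Q) (f y * poly_eval P y)%:E)%E.
  have := poly_proj_orthogonal projP int_f.
  under eq_integral do rewrite mulrBl EFinB.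
  rewrite integralB// => /eqP; rewrite sube_eq ?add0e => [/eqP->//| |].
    exact: integrable_fin_num.
  by rewrite fin_num_adde_defl//; exact: integrable_fin_num.
have m2 : m ^+ 2 <= (K * m) * a.
  have := power_mean mQ (measure_cube Q) v0 (ler1n R 2) mnP (fun y _ => normr_ge0 (poly_eval P y)).
  rewrite mE => /(lee_poweR (ler0n R 2)); rewrite lee_fin => /(_ m0).
  rewrite poweRVK//; last first.
    by rewrite mule_ge0 ?lee_fin// integral_ge0// => y _; rewrite lee_fin powR_ge0.
  rewrite poweR_EFin powR_mulrn//.
  under eq_integral do rewrite powR_mulrn// expr2 -normrM
    ger0_norm ?sqr_ge0 -?expr2 ?sqr_ge0// expr2.
  rewrite sqE => H; rewrite -lee_fin (le_trans H)// EFinM -aE muleCA.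
  apply: lee_wpmul2l; first by rewrite lee_fin.
  rewrite -ge0_integralZl//; last 2 first.
  - by apply/measurable_EFinP; exact: measurableT_comp.
  - by rewrite lee_fin mulr_ge0// ltW.
  apply: (le_trans (lee_abs _)); apply: (le_trans (le_abse_integral _ mQ _)).
    by case/integrableP: ifP.
  apply: ge0_le_integral => //.
  - by apply: measurableT_comp => //; case/integrableP: ifP.
  - by apply: measurable_funeM; apply/measurable_EFinP; exact: measurableT_comp.
  - move=> y Qy; rewrite -EFinM lee_fin normrM mulrC ler_wpM2r//; exact: Pm.
have mKa : m <= K * a.
  have [->|mn0] := eqVneq m 0; first by rewrite mulr_ge0// ltW.
  by rewrite -(ler_pM2l (x := m)) ?lt0r ?mn0// -expr2 (le_trans m2)// mulrAC mulrC.
by rewrite (le_trans (Pm _ Qx))// -mulrA ler_wpM2l// ltW.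
Qed.

(* [poly_proj] is [0] when no projection exists; the bound covers this case too. *)
Lemma osc_poly_proj (s : nat) (q : R) : 1 <= q -> exists2 C : R, 0 < C &
  forall (Q : cube R n) (f : T -> R), measurable_fun (cube_set Q) f ->
    (osc q Q f (poly_proj s Q f) <= C%:E * osc q Q f 0%R)%E.
Proof.
move=> q1; have q0 : 0 < q by rewrite (lt_le_trans ltr01).
have qn0 : q != 0 by rewrite gt_eqF.
have [K K0 KP] := poly_proj_bound s.
(* On the cube |f - P|^q <= 2^q (|f|^q + (K o)^q), where o is the oscillation about 0; averaging
   gives 2^q (1 + K^q) o^q. The added 1 serves the default projection, for which the two
   oscillations coincide. *)
exists ((2 `^ q * (1 + K `^ q)) `^ q^-1 + 1).
  by rewrite ltr_wpDl// powR_ge0.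
move=> Q f mf.
have C0 : 0 <= (2 `^ q * (1 + K `^ q)) `^ q^-1 by exact: powR_ge0.
have [oy|] := eqVneq (osc q Q f 0) +oo%E.
  by rewrite oy gt0_muley ?leey// lte_fin ltr_wpDl.
rewrite -ltey => ofin.
have mQ := measurable_cube Q.
have v0 := cube_vol_gt0 Q; have iv0 : 0 <= (cube_vol Q)^-1 by rewrite invr_ge0 ltW.
rewrite /poly_proj; case: xgetP => [P _ projP|_]; last first.
  by rewrite lee_pemull ?osc_ge0// lee_fin lerDr.
have avg_osc : ((cube_vol Q)^-1%:E * \int[mu]_(x in cube_set Q) (`|f x|)%:E <= osc q Q f 0%R)%E.
  have := average_le_osc 0 q1 mf.
  by under eq_integral do rewrite poly_eval0 subr0.
pose o := fine (osc q Q f 0).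
have o0 : 0 <= o by rewrite fine_ge0// osc_ge0.
have oE : osc q Q f 0 = o%:E by rewrite fineK// ge0_fin_numE ?osc_ge0.
(* Finiteness of the oscillation about 0 makes [f] integrable on the cube, as [poly_proj_bound]
   requires. *)
have int_f : mu.-integrable (cube_set Q) (EFin \o f).
  apply/integrableP; split; first exact/measurable_EFinP.
  have := le_lt_trans avg_osc ofin; rewrite lte_pdivrMl// mulry gtr0_sg// mul1e; exact.
have PB x : cube_set Q x -> `|poly_eval P x| <= K * o.
  move=> Qx; rewrite -lee_fin (le_trans (KP _ _ _ _ projP int_f Qx))// EFinM -oE.
  by apply: lee_wpmul2l => //; rewrite lee_fin ltW.
have oq : ((cube_vol Q)^-1%:E * \int[mu]_(x in cube_set Q) (`|f x| `^ q)%:E = (o `^ q)%:E)%E.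
  rewrite -poweR_EFin -oE poweRVK ?mean_oscillation_ge0// mean_oscillationE.
  by under [in RHS]eq_integral do rewrite poly_eval0 subr0.
rewrite oE (@le_trans _ _ ((2 `^ q * (1 + K `^ q)) `^ q^-1 * o)%:E)//; last first.
  by rewrite -EFinM lee_fin ler_wpM2r// lerDl.
have oK : o = (o `^ q) `^ q^-1 by rewrite -powRrM divff// powRr1.
rewrite [X in (_ * X)%:E]oK -powRM ?mulr_ge0 ?addr_ge0 ?powR_ge0//.
rewrite -poweR_EFin; apply: lee_poweR; first by rewrite invr_ge0 ltW.
  exact: mean_oscillation_ge0.
rewrite mean_oscillationE -mulrA mulrDl mul1r -powRM// ?(ltW K0)//.
have mfq : measurable_fun (cube_set Q) (fun x => (`|f x| `^ q)%:E).
  apply/measurable_EFinP; apply: (@measurableT_comp _ _ _ _ _ _ (@powR R ^~ q)) => //.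
  exact: measurableT_comp.
apply: (@le_trans _ _ ((cube_vol Q)^-1%:E * \int[mu]_(x in cube_set Q)
    ((2 `^ q)%:E * ((`|f x| `^ q)%:E + cst ((K * o) `^ q)%:E x)))%E).
  apply: lee_wpmul2l; first by rewrite lee_fin.
  apply: ge0_le_integral => //.
  - apply/measurable_EFinP; apply: (@measurableT_comp _ _ _ _ _ _ (@powR R ^~ q)) => //.
    exact: measurable_abs_diff_poly.
  - by apply: measurable_funeM; apply: emeasurable_funD.
  - move=> x Qx /=; rewrite -EFinD -EFinM lee_fin.
    have Ko0 : 0 <= K * o by rewrite mulr_ge0// ltW.
    have : `|f x - poly_eval P x| <= `|f x| + K * o.
      by rewrite (le_trans (ler_normB _ _))// lerD2l PB.
    have [fK|Kf] := leP `|f x| (K * o) => H.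
      apply: (@le_trans _ _ ((2 * (K * o)) `^ q)).
        apply: ge0_ler_powR; [exact: ltW|by rewrite nnegrE|by rewrite nnegrE mulr_ge0|].
        by rewrite (le_trans H)// mulr_natl mulr2n lerD2r.
      by rewrite [leLHS]powRM// ler_wpM2l ?powR_ge0// lerDr powR_ge0.
    apply: (@le_trans _ _ ((2 * `|f x|) `^ q)).
      apply: ge0_ler_powR; [exact: ltW|by rewrite nnegrE|by rewrite nnegrE mulr_ge0|].
      by rewrite (le_trans H)// mulr_natl mulr2n lerD2l ltW.
    by rewrite [leLHS]powRM// ler_wpM2l ?powR_ge0// lerDl powR_ge0.
rewrite ge0_integralZl//; last 2 first.
- exact: emeasurable_funD.
- by move=> x _; rewrite adde_ge0// lee_fin powR_ge0.
rewrite ge0_integralD//; last by move=> x _; rewrite lee_fin powR_ge0.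
rewrite integral_cst// measure_cube muleCA EFinM ge0_muleDr; last 2 first.
- by apply: integral_ge0 => x _; rewrite lee_fin powR_ge0.
- by rewrite mule_ge0// lee_fin ?powR_ge0// ltW.
rewrite oq muleCA -(EFinM _^-1) mulVf ?gt_eqF// mule1.
by rewrite -EFinD.
Qed.

End projection.

(** * Comparison of the jn, JN and L^p norms over families of cubes *)

Lemma esum_natE (R : realType) (D : set nat) (a : nat -> \bar R) :
  (forall j, 0 <= a j)%E -> (\esum_(j in D) a j = \sum_(j <oo | j \in D) a j)%E.
Proof.
move=> a0; rewrite nneseries_esum//; congr esum.
by apply/seteqP; split => j /=; rewrite inE.
Qed.

Lemma esumZl_nat (R : realType) (D : set nat) (a : nat -> \bar R) (c : R) :
  0 <= c -> (forall j, 0 <= a j)%E ->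
  (\esum_(j in D) (c%:E * a j) = c%:E * \esum_(j in D) a j)%E.
Proof.
move=> c0 a0; rewrite !esum_natE ?nneseriesZl// => j.
by rewrite mule_ge0.
Qed.

Section comparison.
Context {R : realType} {n : nat}.
Local Notation T := (n.-tuple R).
Local Notation mu := (@lebesgue_measure_tuple R n).

Lemma norm_with_le (pr1 pr2 : cube R n -> (T -> R) -> mpoly n R) (X : domain R n)
    (p q alpha C : R) (f : T -> R) : 0 < p -> 0 <= C ->
  (forall Q, cube_set Q `<=` domain_set X ->
    jn_summand p q alpha Q f (pr1 Q f) <= (C `^ p)%:E * jn_summand p q alpha Q f (pr2 Q f))%E ->
  (norm_with pr1 X p q alpha f <= C%:E * norm_with pr2 X p q alpha f)%E.
Proof.
move=> p0 C0 H; apply: ge_ereal_sup => _ [DQ famDQ <-].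
have Cp0 : 0 <= C `^ p by exact: powR_ge0.
apply: (@le_trans _ _ (C%:E * (\esum_(j in DQ.1) jn_summand p q alpha (DQ.2 j) f
    (pr2 (DQ.2 j) f)) `^ p^-1)%E); last first.
  apply: lee_wpmul2l; first by rewrite lee_fin.
  by apply: ereal_sup_ubound; exists DQ.
rewrite -[X in (X%:E * _)%E](powRr1 C0) -(divff (lt0r_neq0 p0)) powRrM -poweR_EFin.
rewrite -poweRM ?lee_fin//; last by apply: esum_ge0 => j _; exact: jn_summand_ge0.
rewrite -esumZl_nat//; last by move=> j; exact: jn_summand_ge0.
apply: lee_poweR; first by rewrite invr_ge0 ltW.
  by apply: esum_ge0 => j _; exact: jn_summand_ge0.
by apply: le_esum => j Dj; apply: H; exact: famDQ.1.
Qed.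

(** The empty family is admissible, so the supremum is at least a nonnegative value; the cube
    supplied with it is a dummy. *)
Lemma norm_with_ge0 (pr : cube R n -> (T -> R) -> mpoly n R) (X : domain R n)
    (p q alpha : R) (f : T -> R) : (0 <= norm_with pr X p q alpha f)%E.
Proof.
apply: le_trans (ereal_sup_ubound _); last first.
  exists (set0, fun=> Cube [tuple 0 | _ < n] (fun=> true) (fun=> true) ltr01) => //.
  by split => //=; exact: trivIset_set0.
exact: poweR_ge0.
Qed.

Lemma measurable_domain (X : domain R n) : measurable (domain_set X).
Proof. by case: X => [|Q]; [exact: measurableT|exact: measurable_cube]. Qed.

Lemma JN_norm_le_jn_norm (X : domain R n) (p q : R) (s : nat) (alpha c0 : R) :
  0 < p -> 1 <= q -> exists2 C : R, 0 < C &
  forall f, measurable_fun (domain_set X) f ->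
    (JN_norm p q s alpha X f <= C%:E * jn_norm c0 p q s alpha X f)%E.
Proof.
move=> p0 q1; have [C C0 CP] := @osc_poly_proj R n s q q1.
(* On the cubes of side less than [c0] the two summands are equal, so the constant must be at least
   1. *)
exists (C + 1); first by rewrite ltr_wpDl// ltW.
move=> f mf; apply: norm_with_le => // [|Q QX]; first by rewrite addr_ge0// ltW.
apply: le_jn_summand; [exact: ltW|by rewrite addr_ge0// ltW|].
rewrite /poly_proj_c0; case: ifPn => _.
  by rewrite lee_pemull ?osc_ge0// lee_fin lerDr ltW.
apply: (le_trans (CP _ _ _)).
  exact: measurable_funS (measurable_domain X) QX mf.
by apply: lee_wpmul2r; [exact: osc_ge0|rewrite lee_fin lerDl].
Qed.

(** Members of a family may share points of their faces; the open versions are truly disjoint and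
    have the same integrals. *)
Definition open_cube (Q : cube R n) : cube R n :=
  Cube (cube_corner Q) (fun=> false) (fun=> true) (cube_side_gt0 Q).

Lemma open_cube_sub (Q : cube R n) : cube_set (open_cube Q) `<=` cube_set Q.
Proof. by move=> x Qx i; have [_ + _] := cube_edge Q i; apply; exact: Qx. Qed.

Lemma measure_subcubeD (Q' Q : cube R n) :
  cube_side Q' = cube_side Q -> cube_set Q' `<=` cube_set Q ->
  mu (cube_set Q `\` cube_set Q') = 0%E.
Proof.
move=> sQ QQ; set N := _ `\` _.
have : (mu (cube_set Q) = mu N + mu (cube_set Q'))%E.
  by rewrite -(setIidr QQ); apply: measureDI; exact: measurable_cube.
rewrite !measure_cube /cube_vol sQ.
case: (mu N) => [r| |]//; rewrite -EFinD => -[] /eqP.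
by rewrite -subr_eq subrr => /eqP <-.
Qed.

Lemma ge0_integral_subcube (Q' Q : cube R n) (g : T -> \bar R) :
  cube_side Q' = cube_side Q -> cube_set Q' `<=` cube_set Q ->
  measurable_fun (cube_set Q) g -> (forall x, cube_set Q x -> 0 <= g x)%E ->
  (\int[mu]_(x in cube_set Q') g x = \int[mu]_(x in cube_set Q) g x)%E.
Proof.
move=> sQ QQ mg g0; have mQ := measurable_cube Q.
have mN : measurable (cube_set Q `\` cube_set Q').
  by apply: measurableD => //; exact: measurable_cube.
rewrite [RHS](ge0_negligible_integral mN)//; last exact: measure_subcubeD.
by congr integral; rewrite setDD (setIidr QQ).
Qed.

(** Finitely many strict coordinate inequalities define a neighbourhood. This links the cubes,
    described by the order, to the topological interiors whose disjointness defines a family. *)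
Lemma open_cube_interior (Q : cube R n) (x : T) :
  cube_set (open_cube Q) x -> (@vec_of R n @` cube_set Q)° (vec_of x).
Proof.
move=> Qx; rewrite /interior.
have near_cube : \forall v \near vec_of x, forall i,
    tnth (cube_corner Q) i < (v : 'rV[R]_n) 0 i /\
    (v : 'rV[R]_n) 0 i < tnth (cube_corner Q) i + cube_side Q.
  apply: (@filter_forall _ _ (fun i => [set v : 'rV[R]_n |
    tnth (cube_corner Q) i < v 0 i /\
    v 0 i < tnth (cube_corner Q) i + cube_side Q]) _ (nbhs_filter _)) => i.
  have cv : continuous (fun v : 'rV[R]_n => v 0 i) by exact: coord_continuous.
  have := Qx i; rewrite /= in_itv/= => /andP[ax xb].
  have lo : nbhs (vec_of x) [set v : 'rV[R]_n | tnth (cube_corner Q) i < v 0 i].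
    apply: (cv (vec_of x) [set y : R | tnth (cube_corner Q) i < y]).
    apply: open_nbhs_nbhs; split; first exact: open_gt.
    by rewrite /= mxE.
  have hi : nbhs (vec_of x)
      [set v : 'rV[R]_n | v 0 i < tnth (cube_corner Q) i + cube_side Q].
    apply: (cv (vec_of x) [set y : R | y < tnth (cube_corner Q) i + cube_side Q]).
    apply: open_nbhs_nbhs; split; first exact: open_lt.
    by rewrite /= mxE.
  exact: (@filterI _ _ (nbhs_filter _) _ _ lo hi).
apply: (@filterS _ _ (nbhs_filter _) _ _ _ near_cube) => v vQ.
exists [tuple v 0 i | i < n]; last by apply/rowP => i; rewrite mxE tnth_mktuple.
apply: open_cube_sub => i; rewrite tnth_mktuple /= in_itv/=.
by have [-> ->] := vQ i.
Qed.

Lemma sum_integral_cubes_le (X : domain R n) (DQ : set nat * (nat -> cube R n))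
    (g : T -> \bar R) :
  cube_families X DQ -> measurable_fun (domain_set X) g ->
  (forall x, domain_set X x -> 0 <= g x)%E ->
  (\esum_(j in DQ.1) \int[mu]_(x in cube_set (DQ.2 j)) g x <=
    \int[mu]_(x in domain_set X) g x)%E.
Proof.
move=> [sub triv] mg g0; have mX := measurable_domain X.
(* Indices outside the family receive the empty set, so that countable additivity applies to a
   sequence over all of [nat]. *)
pose F j := if j \in DQ.1 then cube_set (open_cube (DQ.2 j)) else set0.
have mF j : measurable (F j).
  by rewrite /F; case: ifPn => // _; exact: measurable_cube.
have FX : \bigcup_j F j `<=` domain_set X.
  move=> x [j _]; rewrite /F; case: ifPn => // /set_mem Dj Fx.
  by apply: sub Dj _ _; exact: open_cube_sub.
have tF : trivIset setT F.
  apply/trivIsetP => i j _ _ ij; rewrite /F.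
  case: ifPn => [/set_mem Di|_]; last by rewrite set0I.
  case: ifPn => [/set_mem Dj|_]; last by rewrite setI0.
  apply/eqP/negPn/negP => /set0P[x [xi xj]].
  move/trivIsetP : triv => /(_ i j Di Dj ij) /seteqP[/(_ (vec_of x)) + _].
  by apply; split; exact: open_cube_interior.
apply: (@le_trans _ _ (\int[mu]_(x in \bigcup_j F j) g x)%E); last first.
  by apply: ge0_subset_integral => //; exact: bigcup_measurable.
rewrite ge0_integral_bigcup//; last 2 first.
- exact: measurable_funS FX mg.
- by move=> x /FX; exact: g0.
rewrite nneseries_esumT; last first.
  move=> j; apply: integral_ge0 => x Fx; apply: g0; apply: FX; by exists j.
rewrite esum_mkcond; apply: le_esum => j _; rewrite /F; case: ifPn => [/set_mem Dj|_].
  rewrite (@ge0_integral_subcube (open_cube (DQ.2 j)) (DQ.2 j))//.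
  - exact: open_cube_sub.
  - exact: measurable_funS (sub _ Dj) mg.
  - by move=> x /(sub _ Dj); exact: g0.
by rewrite integral_set0.
Qed.

Lemma Lp_norm_pow (X : domain R n) (p : R) (f : T -> R) : 0 < p ->
  (Lp_norm X p f `^ p = \int[mu]_(x in domain_set X) (`|f x| `^ p)%:E)%E.
Proof.
move=> p0; have pn0 : p != 0 by rewrite gt_eqF.
apply: (eq_trans (poweR_Lnorm _ _ pn0)); rewrite [RHS]integral_mkcond.
apply: eq_integral => x _; rewrite /= !patchE; case: ifPn => //= _.
by rewrite normr0 powR0.
Qed.

(** Jensen's inequality with exponent p/q for |f|^q. For positive [alpha] the remaining power of the
    volume is negative, hence bounded over the cubes of side at least [c0]. *)
Lemma jn_summand0_le (p q alpha : R) (Q : cube R n) (f : T -> R) :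
  1 <= q -> q <= p -> measurable_fun (cube_set Q) f ->
  (jn_summand p q alpha Q f 0%R <= (cube_vol Q `^ (- (alpha * p)))%:E *
    \int[mu]_(x in cube_set Q) (`|f x| `^ p)%:E)%E.
Proof.
move=> q1 qp mf; have q0 : 0 < q by rewrite (lt_le_trans ltr01).
have qn0 : q != 0 by rewrite gt_eqF.
have p0 : 0 < p by rewrite (lt_le_trans q0).
have v0 := cube_vol_gt0 Q.
have I0 (g : T -> R) : (forall x, 0 <= g x) -> (0 <= \int[mu]_(x in cube_set Q) (g x)%:E)%E.
  by move=> g0; apply: integral_ge0 => x _; rewrite lee_fin.
have vE : cube_vol Q `^ (1 - alpha * p) = cube_vol Q `^ (- (alpha * p)) * cube_vol Q.
  rewrite powRD; last by rewrite (gt_eqF v0) implybT.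
  by rewrite powRr1 ?(ltW v0)// mulrC.
rewrite jn_summandE vE EFinM -muleA.
apply: lee_wpmul2l; first by rewrite lee_fin powR_ge0.
rewrite -lee_pdivlMl//.
have mfq : measurable_fun (cube_set Q) (fun x => `|f x| `^ q).
  apply: (@measurableT_comp _ _ _ _ _ _ (@powR R ^~ q)) => //.
  exact: measurableT_comp.
have r1 : 1 <= p / q by rewrite ler_pdivlMr ?mul1r.
have := power_mean (measurable_cube Q) (measure_cube Q) v0 r1 mfq (fun x _ => powR_ge0 _ _).
under [in leRHS]eq_integral do rewrite -powRrM mulrCA divff// mulr1.
rewrite invf_div => H.
rewrite /osc mean_oscillationE; under eq_integral do rewrite poly_eval0 subr0.
rewrite -poweRrM [q^-1 * p]mulrC.
have iv0 : (0 <= (cube_vol Q)^-1%:E)%E by rewrite lee_fin invr_ge0 ltW.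
have pq0 : 0 <= p / q by rewrite divr_ge0// ltW.
apply: (le_trans (lee_poweR pq0 _ H)).
  by rewrite mule_ge0// I0// => x; exact: powR_ge0.
have qpE : q / p * (p / q) = 1 by field; rewrite !gt_eqF.
rewrite -poweRrM qpE poweRe1//.
by rewrite mule_ge0// I0// => x; exact: powR_ge0.
Qed.

Lemma jn_norm_le_max (X : domain R n) (p q : R) (s : nat) (alpha c0 : R) :
  1 <= q -> q <= p -> 0 < alpha -> 0 < c0 -> exists2 B : R, 0 < B &
  forall f, measurable_fun (domain_set X) f ->
    (jn_norm c0 p q s alpha X f <=
       B%:E * maxe (JN_norm p q s alpha X f) (Lp_norm X p f))%E.
Proof.
move=> q1 qp al0 c00; have q0 : 0 < q by rewrite (lt_le_trans ltr01).
have p0 : 0 < p by rewrite (lt_le_trans q0).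
pose E := (c0 ^+ n) `^ (- (alpha * p)).
have E0 : 0 <= E by exact: powR_ge0.
(* The p-th power of the norm will be bounded by that of the JN norm plus [E] times that of the L^p
   norm, hence by 1 + E times that of the maximum. *)
exists ((1 + E) `^ p^-1); first by rewrite powR_gt0// ltr_pwDl.
move=> f mf; set M := maxe _ _.
have JN0 : (0 <= JN_norm p q s alpha X f)%E by exact: norm_with_ge0.
have M0 : (0 <= M)%E by rewrite le_max JN0.
apply: ge_ereal_sup => _ [DQ famDQ <-].
rewrite -(@poweRK R p M) ?gt_eqF// -poweR_EFin -poweRM ?lee_fin ?addr_ge0 ?poweR_ge0//.
apply: lee_poweR; first by rewrite invr_ge0 ltW.
  by apply: esum_ge0 => j _; exact: jn_summand_ge0.
have mfp : measurable_fun (domain_set X) (fun x => (`|f x| `^ p)%:E).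
  apply/measurable_EFinP; apply: (@measurableT_comp _ _ _ _ _ _ (@powR R ^~ p)) => //.
  exact: measurableT_comp.
(* The first term pays for the cubes of side less than [c0], the second for the others; keeping both
   for every cube avoids splitting the family. *)
apply: (@le_trans _ _ (\esum_(j in DQ.1)
    (jn_summand p q alpha (DQ.2 j) f (poly_proj s (DQ.2 j) f) +
     E%:E * \int[mu]_(x in cube_set (DQ.2 j)) (`|f x| `^ p)%:E))%E).
  apply: le_esum => j Dj; have QX := famDQ.1 j Dj.
  have I0 : (0 <= \int[mu]_(x in cube_set (DQ.2 j)) (`|f x| `^ p)%:E)%E.
    by apply: integral_ge0 => x _; rewrite lee_fin powR_ge0.
  rewrite /poly_proj_c0; case: ifPn => [_|].
    by rewrite leeDl// mule_ge0.
  rewrite -leNgt => c0Q; apply: (@le_trans _ _ (E%:E *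
    \int[mu]_(x in cube_set (DQ.2 j)) (`|f x| `^ p)%:E)%E); last first.
    by rewrite leeDr// jn_summand_ge0.
  apply: (le_trans (jn_summand0_le _ q1 qp _)).
    exact: measurable_funS (measurable_domain X) QX mf.
  have vol_le : c0 ^+ n <= cube_vol (DQ.2 j).
    by apply: lerXn2r; rewrite ?nnegrE ?(ltW c00) ?(ltW (cube_side_gt0 _)).
  have ap0 : 0 <= alpha * p by rewrite mulr_ge0// ltW.
  apply: lee_wpmul2r => //; rewrite lee_fin /E !powRN.
  rewrite lef_pV2 ?posrE ?powR_gt0 ?cube_vol_gt0 ?exprn_gt0//.
  apply: ge0_ler_powR; rewrite ?nnegrE ?(ltW (cube_vol_gt0 _)) ?exprn_ge0 ?(ltW c00)//.
rewrite esumD; last 2 first.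
- by move=> j _; exact: jn_summand_ge0.
- move=> j _; rewrite mule_ge0// integral_ge0// => x _; by rewrite lee_fin powR_ge0.
rewrite esumZl_nat//; last by move=> j; rewrite integral_ge0// => x _; rewrite lee_fin powR_ge0.
rewrite EFinD ge0_muleDl// mul1e; apply: leeD.
  apply: (@le_trans _ _ (JN_norm p q s alpha X f `^ p)%E); last first.
    by apply: lee_poweR; rewrite ?(ltW p0)// le_max lexx.
  rewrite -[leLHS](@poweRVK R p) ?gt_eqF//; last first.
    by apply: esum_ge0 => j _; exact: jn_summand_ge0.
  apply: lee_poweR; rewrite ?(ltW p0) ?poweR_ge0//.
  by apply: ereal_sup_ubound; exists DQ.
apply: lee_wpmul2l; first by rewrite lee_fin.
apply: (le_trans (sum_integral_cubes_le famDQ mfp _)).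
  by move=> x _; rewrite lee_fin powR_ge0.
rewrite -Lp_norm_pow//; apply: lee_poweR; rewrite ?(ltW p0) ?Lnorm_ge0//.
by rewrite le_max lexx orbT.
Qed.

End comparison.

(** * Dyadic grids *)

Section grid.
Context {R : realType} {n : nat}.
Local Notation T := (n.-tuple R).
Local Notation mu := (@lebesgue_measure_tuple R n).
Variables (o : T) (L : R) (L0 : 0 < L).

Definition mesh (k : nat) : R := L / 2 ^+ k.

Lemma mesh_gt0 k : 0 < mesh k.
Proof. by rewrite divr_gt0// exprn_gt0. Qed.

Lemma meshS k : mesh k = 2 * mesh k.+1.
Proof. by rewrite /mesh exprS; field; rewrite expf_neq0. Qed.

Definition cell_idx (k : nat) (x : T) : {ffun 'I_n -> int} :=
  [ffun i => Num.floor ((tnth x i - tnth o i) / mesh k)].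

(* Cube families are indexed by [nat], so the cells of a grid are numbered. *)
Definition cell_no (k : nat) (x : T) : nat := pickle (cell_idx k x).

Definition cell_corner (k : nat) (x : T) : T :=
  [tuple tnth o i + (cell_idx k x i)%:~R * mesh k | i < n].

(** Half-open cells partition the space and serve pointwise arguments. Open cells are the members of
    the cube families: they remain inside a cube domain whichever faces it has. *)
Definition half_cell (k : nat) (x : T) : cube R n :=
  Cube (cell_corner k x) (fun=> true) (fun=> true) (mesh_gt0 k).

Definition open_cell (k : nat) (x : T) : cube R n :=
  Cube (cell_corner k x) (fun=> false) (fun=> true) (mesh_gt0 k).

Lemma cell_idxP k (x : T) i (m : int) : cell_idx k x i = m <->
  tnth o i + m%:~R * mesh k <= tnth x i < tnth o i + m%:~R * mesh k + mesh k.
Proof.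
have h0 := mesh_gt0 k; rewrite ffunE.
have -> : tnth o i + m%:~R * mesh k + mesh k = tnth o i + (m + 1)%:~R * mesh k.
  by rewrite intrD mulrDl mul1r addrA.
rewrite -lerBrDl -ltrBlDl -ler_pdivlMr// -ltr_pdivrMr//.
split=> [<-|]; first by rewrite floor_le_tmp floorD1_gt.
by move=> H; apply: floor_def.
Qed.

Lemma half_cellP k (x y : T) : cube_set (half_cell k x) y <-> cell_no k y = cell_no k x.
Proof.
split=> [yx|yx i].
  congr pickle; apply/ffunP => i; apply/cell_idxP.
  by have := yx i; rewrite /= in_itv/= tnth_mktuple.
rewrite /= in_itv/= tnth_mktuple; apply/cell_idxP.
by move/(pcan_inj pickleK) : yx => ->.
Qed.

Lemma open_cell_half k (x : T) : cube_set (open_cell k x) `<=` cube_set (half_cell k x).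
Proof.
move=> y yx i; have := yx i; rewrite /= !in_itv/= => /andP[/ltW -> ->//].
Qed.

Lemma cell_no_open k (x y : T) : cube_set (open_cell k x) y -> cell_no k y = cell_no k x.
Proof. by move/open_cell_half/half_cellP. Qed.

Lemma open_cell_eq k (x y : T) : cell_no k y = cell_no k x -> open_cell k y = open_cell k x.
Proof. by move/(pcan_inj pickleK) => yx; rewrite /open_cell /cell_corner yx. Qed.

Lemma half_cell_closed k (x : T) : in_closed_cube (open_cell k x) x.
Proof.
by move=> i; have /half_cellP/cube_set_closed/(_ i) := erefl (cell_no k x).
Qed.

(** The floor of t is the largest integer m such that 2m is at most the floor of 2t, so the finer
    index determines the coarser one in each coordinate. *)
Lemma cell_noS k (x y : T) : cell_no k.+1 y = cell_no k.+1 x -> cell_no k y = cell_no k x.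
Proof.
move/(pcan_inj pickleK) => yx; congr pickle; apply/ffunP => i.
have /ffunP/(_ i) := yx; rewrite !ffunE => {}yx.
have h0 := mesh_gt0 k.+1.
pose t (z : T) := (tnth z i - tnth o i) / mesh k.
have tE (z : T) : (tnth z i - tnth o i) / mesh k.+1 = 2 * t z.
  by rewrite /t (meshS k); field; rewrite gt_eqF.
rewrite !tE in yx; rewrite -/(t x) -/(t y).
apply/eqP; rewrite eq_le; apply/andP; split.
- rewrite floor_ge_int_tmp.
  have : (2 * Num.floor (t y) <= Num.floor (2 * t x))%R.
    by rewrite -yx floor_ge_int_tmp intrM ler_pM2l// floor_le_tmp.
  by rewrite floor_ge_int_tmp intrM ler_pM2l.
- rewrite floor_ge_int_tmp.
  have : (2 * Num.floor (t x) <= Num.floor (2 * t y))%R.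
    by rewrite yx floor_ge_int_tmp intrM ler_pM2l// floor_le_tmp.
  by rewrite floor_ge_int_tmp intrM ler_pM2l.
Qed.

Lemma cell_no_le k k' (x y : T) : (k <= k')%N ->
  cell_no k' y = cell_no k' x -> cell_no k y = cell_no k x.
Proof.
move=> /subnKC <-; elim: (k' - k)%N => [|d IH]; first by rewrite addn0.
by rewrite addnS => /cell_noS.
Qed.

Lemma open_cellS k (x : T) : cube_set (open_cell k.+1 x) `<=` cube_set (open_cell k x).
Proof.
move=> z zx i; have /half_cellP/(_ i) := cell_noS (cell_no_open zx).
rewrite /= !in_itv/= => /andP[_ ->]; rewrite andbT.
(* The lower inequality must be strict. The corner of the fine cell lies in the coarse half-open
   cell, so the coarse corner is at most the fine one, which is strictly below [z]. *)
have /half_cellP/cell_noS/half_cellP/(_ i) : cube_set (half_cell k.+1 x) (cell_corner k.+1 x).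
  by move=> j; rewrite /= in_itv/= lexx ltrDl mesh_gt0.
rewrite /= in_itv/= => /andP[le_corner _]; apply: (le_lt_trans le_corner).
by have := zx i; rewrite /= in_itv/= => /andP[].
Qed.

Lemma open_cell0 k (x : T) : cube_set (open_cell k x) `<=` cube_set (open_cell 0 x).
Proof. by elim: k => // k IH; exact: subset_trans (@open_cellS k x) IH. Qed.

Definition cell (k j : nat) : set T := [set x | cell_no k x = j].

Lemma cellE k (x : T) : cell k (cell_no k x) = cube_set (half_cell k x).
Proof. by apply/seteqP; split => y /half_cellP. Qed.

Lemma measurable_cell k j : measurable (cell k j).
Proof.
have [[x <-]|nx] := pselect (exists x, cell_no k x = j).
  by rewrite cellE; exact: measurable_cube.
rewrite (_ : cell k j = set0)//; apply/seteqP; split => // x xj.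
by case: nx; exists x.
Qed.

Lemma measurable_cell_no k (A : set nat) : measurable (cell_no k @^-1` A).
Proof.
rewrite (_ : _ @^-1` _ = \bigcup_(j in A) cell k j).
  by apply: bigcup_measurable => j _; exact: measurable_cell.
by apply/seteqP; split => [x Ax|x [j Aj xj]]; [exists (cell_no k x)|rewrite /= xj].
Qed.

(** The cells are measurable and countably many, so measurability can be checked on each of them. *)
Lemma measurable_piecewise d' (U : measurableType d') k (F : nat -> T -> U) :
  (forall j, measurable_fun setT (F j)) ->
  measurable_fun setT (fun x => F (cell_no k x) x).
Proof.
move=> mF _ A mA; rewrite setTI.
rewrite (_ : _ @^-1` _ = \bigcup_j (cell k j `&` F j @^-1` A)).
  apply: bigcupT_measurable => j; apply: measurableI; first exact: measurable_cell.
  by rewrite -[X in measurable X]setTI; exact: mF.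
by apply/seteqP; split => [x Ax|x [j _ [xj Fx]]]; [exists (cell_no k x)|rewrite /= xj].
Qed.

(** That is, [B] is a union of half-open cells of the [k]-th grid. *)
Definition saturated (k : nat) (B : set T) :=
  forall x y, cell_no k y = cell_no k x -> B x -> B y.

Lemma measurable_saturated k (B : set T) : saturated k B -> measurable B.
Proof.
move=> satB; rewrite (_ : B = cell_no k @^-1` (cell_no k @` B)); first exact: measurable_cell_no.
apply/seteqP; split => [x Bx|x [y By yx]]; first by exists x.
by apply: satB By.
Qed.

(** Recovers a cube from a cell number through a representative; numbers of no cell receive [o]. *)
Definition cell_point (k j : nat) : T := xget o (cell k j).

Lemma cell_pointK k x : cell_no k (cell_point k (cell_no k x)) = cell_no k x.
Proof. by have := @xgetPex _ o (cell k (cell_no k x)) (ex_intro _ x erefl). Qed.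

Lemma open_cell_point k x : open_cell k (cell_point k (cell_no k x)) = open_cell k x.
Proof. by apply: open_cell_eq; exact: cell_pointK. Qed.

(** The half-open cells cut [B] into countably many disjoint pieces, and each may be replaced by its
    open cell since the faces are null. *)
Lemma integral_saturated k (B : set T) (g : T -> \bar R) :
  saturated k B -> measurable_fun B g -> (forall x, B x -> 0 <= g x)%E ->
  (\int[mu]_(x in B) g x =
   \esum_(j in cell_no k @` B) \int[mu]_(x in cube_set (open_cell k (cell_point k j))) g x)%E.
Proof.
move=> satB mg g0.
pose F j := if j \in cell_no k @` B then cell k j else set0.
have mF j : measurable (F j) by rewrite /F; case: ifPn => // _; exact: measurable_cell.
have BE : B = \bigcup_j F j.
  apply/seteqP; split => [x Bx|x [j _]].
    by exists (cell_no k x) => //; rewrite /F ifT// inE; exists x.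
  by rewrite /F; case: ifPn => // /set_mem[y By <-] xy; apply: satB By.
have tF : trivIset setT F.
  apply/trivIsetP => i j _ _ /eqP ij; rewrite /F.
  case: ifPn => _; last by rewrite set0I.
  case: ifPn => _; last by rewrite setI0.
  by apply/seteqP; split => // x [/= xi xj]; apply: ij; rewrite -xi -xj.
rewrite [in LHS]BE ge0_integral_bigcup -?BE//.
rewrite nneseries_esumT; last first.
  by move=> j; apply: integral_ge0 => x Fx; apply: g0; rewrite BE; exists j.
rewrite [RHS]esum_mkcond; apply: eq_esum => j _; rewrite /F; case: ifPn => [|_].
  move=> /set_mem[x Bx <-]; rewrite open_cell_point cellE.
  have HB : cube_set (half_cell k x) `<=` B.
    by move=> y /half_cellP yx; exact: satB yx Bx.
  apply/esym/ge0_integral_subcube => //.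
  - exact: open_cell_half.
  - by apply: measurable_funS HB mg; exact: measurable_saturated satB.
  - by move=> y /HB; exact: g0.
by rewrite integral_set0.
Qed.

(** Interiors of distinct open cells are disjoint because a common point would have two cell
    numbers. *)
Lemma cube_families_cells k (X : domain R n) (B : set T) :
  (forall x, B x -> cube_set (open_cell k x) `<=` domain_set X) ->
  cube_families X (cell_no k @` B, fun j => open_cell k (cell_point k j)).
Proof.
move=> BX; split => /= [_ [x Bx <-]|].
  by rewrite open_cell_point; exact: BX.
apply/trivIsetP => _ _ [x Bx <-] [y By <-] /eqP xy; rewrite !open_cell_point.
apply/seteqP; split => // v [/interior_subset[z zx <-] /interior_subset[w wy]].
move=> /rowP wz; apply: xy; rewrite -(cell_no_open zx) -(cell_no_open wy).
by congr cell_no; apply: eq_from_tnth => i; have := wz i; rewrite !mxE.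
Qed.

End grid.

(** * Minkowski and Fatou *)

Section limits.
Context d (T : measurableType d) (R : realType) (mu : {measure set T -> \bar R}).
Variable D : set T.
Hypothesis mD : measurable D.

Lemma measurable_powR_norm (p : R) (F : T -> R) :
  measurable_fun D F -> measurable_fun D (fun x => (`|F x| `^ p)%:E).
Proof.
move=> mF; apply/measurable_EFinP.
apply: (@measurableT_comp _ _ _ _ _ _ (@powR R ^~ p)) => //.
exact: measurableT_comp.
Qed.

(** Minkowski's inequality stated on p-th powers with real bounds, ready to be iterated in an
    induction. *)
Lemma minkowski_le (p : R) (F G H : T -> R) (a b : R) :
  1 <= p -> 0 <= a -> 0 <= b ->
  measurable_fun D F -> measurable_fun D G -> measurable_fun D H ->
  (forall x, D x -> `|H x| <= `|F x| + `|G x|) ->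
  (\int[mu]_(x in D) (`|F x| `^ p)%:E <= (a `^ p)%:E)%E ->
  (\int[mu]_(x in D) (`|G x| `^ p)%:E <= (b `^ p)%:E)%E ->
  (\int[mu]_(x in D) (`|H x| `^ p)%:E <= ((a + b) `^ p)%:E)%E.
Proof.
move=> p1 a0 b0 mF mG mH HFG Fa Gb.
have p0 : 0 < p by rewrite (lt_le_trans ltr01).
have pn0 : p != 0 by rewrite gt_eqF.
have Lpow (h : T -> R) : ('N[mu]_p%:E[EFin \o (h \_ D)] `^ p =
    \int[mu]_(x in D) (`|h x| `^ p)%:E)%E.
  apply: (eq_trans (poweR_Lnorm _ _ pn0)); rewrite [RHS]integral_mkcond.
  apply: eq_integral => x _.
  by rewrite /= !patchE; case: ifPn => //= _; rewrite normr0 powR0.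
have Lle (h : T -> R) c : 0 <= c -> (\int[mu]_(x in D) (`|h x| `^ p)%:E <= (c `^ p)%:E)%E ->
    ('N[mu]_p%:E[EFin \o (h \_ D)] <= c%:E)%E.
  move=> c0; rewrite -Lpow => hc.
  rewrite -[leLHS](@poweRK R p) ?Lnorm_ge0// -[leRHS](@poweRK R p) ?lee_fin//.
  by apply: lee_poweR => //; rewrite ?invr_ge0 ?(ltW p0)// poweR_ge0.
(* Absolute values are summed, since [H] is dominated by |F| + |G| and not by |F + G|. *)
pose F1 := (fun x => `|F x|) \_ D; pose G1 := (fun x => `|G x|) \_ D.
have mF1 : measurable_fun setT F1.
  by apply/(measurable_restrictT _ mD); exact: measurableT_comp.
have mG1 : measurable_fun setT G1.
  by apply/(measurable_restrictT _ mD); exact: measurableT_comp.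
have := minkowski_EFin mu mF1 mG1 p1 => mink.
have {}mink : ('N[mu]_p%:E[EFin \o (F1 \+ G1)%R] <= (a + b)%:E)%E.
  apply: (le_trans mink (leeD (Lle _ _ a0 _) (Lle _ _ b0 _))).
    by under eq_integral do rewrite normr_id.
  by under eq_integral do rewrite normr_id.
have {mink} := lee_poweR (ltW p0) (Lnorm_ge0 _ _ _) mink.
have FGE : ((F1 \+ G1) = (fun x => `|F x| + `|G x|) \_ D)%R.
  by apply/funext => x; rewrite /F1 /G1 /= !patchE; case: ifPn => //; rewrite addr0.
rewrite FGE Lpow; apply: le_trans; apply: ge0_le_integral => //.
- exact: measurable_powR_norm.
- by apply: measurable_powR_norm; apply: measurable_funD => //; exact: measurableT_comp.
- move=> x Dx; rewrite lee_fin; apply: ge0_ler_powR; rewrite ?nnegrE ?(ltW p0)//.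
  by rewrite [leRHS]ger0_norm ?addr_ge0// HFG.
Qed.

(** The sum of the series is integrable, hence finite almost everywhere, and the terms of a
    convergent series tend to 0. *)
Lemma ae_cvg0 (u : nat -> T -> R) :
  (forall k, measurable_fun D (u k)) -> (forall k x, D x -> 0 <= u k x) ->
  (\sum_(k <oo) \int[mu]_(x in D) (u k x)%:E < +oo)%E ->
  exists N, [/\ measurable N, mu N = 0%E &
    forall x, D x -> ~ N x -> u ^~ x @ \oo --> 0].
Proof.
move=> mu_ u0 sum_fin.
pose U x := (\sum_(k <oo) (u k x)%:E)%E.
have u0e k x : D x -> (0 <= (u k x)%:E)%E by move=> Dx; rewrite lee_fin u0.
have mue k : measurable_fun D (fun x => (u k x)%:E) by exact/measurable_EFinP.
have U0 x : D x -> (0 <= U x)%E by move=> Dx; apply: nneseries_ge0 => k _ _; exact: u0e.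
have intU : mu.-integrable D U.
  apply/integrableP; split.
    by apply: ge0_emeasurable_sum => // k x Dx _; exact: u0e.
  under eq_integral => x /set_mem Dx do rewrite gee0_abs ?U0//.
  by rewrite integral_nneseries.
have [N [mN N0 DN]] := integrable_ae mD intU.
exists N; split => // x Dx Nx.
have Ufin : U x \is a fin_num.
  by apply: contrapT => Ux; apply: Nx; apply: DN => /= /(_ Dx).
apply: cvg_series_cvg_0; apply: nondecreasing_is_cvgn.
  apply/nondecreasing_seqP => k; rewrite /series/= big_nat_recr//= lerDl.
  exact: u0.
exists (fine (U x)) => _ [k _ <-]; rewrite -lee_fin fineK// /series/= -sumEFin.
by apply: nneseries_lim_ge => j _ _; exact: u0e.
Qed.

Lemma fatou_powR (p c : R) (F : T -> R) (G : nat -> T -> R) :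
  0 < p -> measurable_fun D F -> (forall k, measurable_fun D (G k)) ->
  (forall x, D x -> (fun k => `|F x - G k x|) @ \oo --> 0) ->
  (forall k, \int[mu]_(x in D) (`|G k x| `^ p)%:E <= c%:E)%E ->
  (\int[mu]_(x in D) (`|F x| `^ p)%:E <= c%:E)%E.
Proof.
move=> p0 mF mG FG Gc.
pose h k x := (`|G k x| `^ p)%:E.
have mh k : measurable_fun D (h k) by exact: measurable_powR_norm.
have h0 k x : D x -> (0 <= h k x)%E by move=> _; rewrite lee_fin powR_ge0.
apply: (@le_trans _ _ (\int[mu]_(x in D) limn_einf (h ^~ x))%E).
  have le_liminf x : D x -> ((`|F x| `^ p)%:E <= limn_einf (h ^~ x))%E.
    (* Continuity of the power is obtained from its derivative, which requires a positive base; at a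
       zero of [F] the claim is mere nonnegativity. *)
    move=> Dx; have [Fx0|Fx0] := eqVneq (F x) 0.
      rewrite Fx0 normr0 powR0 ?gt_eqF// limn_einf_lim.
      apply: lime_ge; first exact: is_cvg_einfs.
      by apply: nearW => k; apply: le_ereal_inf_tmp => _ [m _ <-]; exact: h0.
    have cG : (fun k => `|G k x|) @ \oo --> `|F x|.
      apply: cvg_norm; apply/cvgrPdist_lt => e e0.
      have /cvgrPdist_lt/(_ e e0) := FG x Dx.
      by apply: filterS => k; rewrite sub0r normrN normr_id.
    have cp : {for `|F x|, continuous (@powR R ^~ p)}.
      apply: differentiable_continuous; apply/derivable1_diffP.
      by apply: derivable_powR; rewrite in_itv/= andbT normr_gt0.
    have /cvg_limn_einf_sup[-> _] // : h ^~ x @ \oo --> (`|F x| `^ p)%:E.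
    apply: cvg_EFin; first exact: nearW.
    by have := cvg_comp (fun k => `|G k x|) (@powR R ^~ p) cG cp; exact.
  apply: ge0_le_integral => //; first exact: measurable_powR_norm.
  rewrite (_ : (fun x => _) = (fun x => - limn_esup (fun k => - h k x))%E) //.
  apply: measurableT_comp => //; apply: measurable_fun_limn_esup => k.
  exact: measurableT_comp.
apply: (le_trans (fatou mu mD mh h0)); rewrite limn_einf_lim.
apply: lime_le; first exact: is_cvg_einfs.
apply: nearW => k; apply: le_trans (Gc k).
by apply: ereal_inf_lbound; exists k => /=.
Qed.

End limits.

(** * Convergence along the grids *)

Section estimates.
Context {R : realType} {n : nat}.
Local Notation T := (n.-tuple R).
Local Notation mu := (@lebesgue_measure_tuple R n).
Variables (X : domain R n) (p q : R) (s : nat) (alpha c0 : R).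
Hypotheses (n_gt0 : (0 < n)%N) (p1 : 1 <= p) (q1 : 1 <= q) (al0 : 0 < alpha).
Variables (o : T) (L : R) (L0 : 0 < L) (c0L : c0 <= L).
Variable K : R.
Hypothesis K0 : 0 < K.
Hypothesis KP : forall (q : R) (Q' Q : cube R n) f P' P x, 1 <= q ->
  cube_set Q' `<=` cube_set Q -> cube_side Q = 2 * cube_side Q' ->
  (msize P' <= s.+1)%N -> (msize P <= s.+1)%N -> measurable_fun (cube_set Q) f ->
  in_closed_cube Q' x ->
  ((`|poly_eval P' x - poly_eval P x|)%:E <=
     K%:E * (osc q Q' f P' + osc q Q f P))%E.
Variables (f : T -> R) (mf : measurable_fun (domain_set X) f).
Variables (N : R) (N0 : 0 <= N) (jnN : (jn_norm c0 p q s alpha X f <= N%:E)%E).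

Let p0 : 0 < p. Proof. exact: lt_le_trans p1. Qed.
Let pn0 : p != 0. Proof. by rewrite gt_eqF. Qed.
Let proj (Q : cube R n) := poly_proj_c0 c0 s Q f.
Let C k x := open_cell o L0 k x.
(** [fine] would send an infinite oscillation to 0; [OE] excludes this on [Y]. *)
Let O k x : R := fine (osc q (C k x) f (proj (C k x))).
Let G k x : R := poly_eval (proj (C k x)) x.
(** The set on which all grids are admissible, as finer open cells lie in the coarsest one. With the
    grids chosen later it covers the domain up to a null set. *)
Let Y := [set x | cube_set (C 0%N x) `<=` domain_set X].
(** The factor |Q|^alpha for a cell of the [k]-th grid; it decays geometrically with the ratio [r]
    defined next. *)
Let a k : R := (mesh L k ^+ n) `^ alpha.
Let r : R := (2 ^+ n) `^ (- alpha).

Lemma msize_poly_proj_c0 Q : (msize (proj Q) <= s.+1)%N.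
Proof.
rewrite /proj /poly_proj_c0; case: ifPn => _; last by rewrite msize0.
by rewrite /poly_proj; case: xgetP => [P _ []//|_]; rewrite msize0.
Qed.

Lemma esum_summand_le (DQ : set nat * (nat -> cube R n)) : cube_families X DQ ->
  (\esum_(j in DQ.1) jn_summand p q alpha (DQ.2 j) f (proj (DQ.2 j)) <= (N `^ p)%:E)%E.
Proof.
move=> famDQ; rewrite -[leLHS](@poweRVK R p)//; last first.
  by apply: esum_ge0 => j _; exact: jn_summand_ge0.
rewrite -poweR_EFin; apply: lee_poweR; rewrite ?(ltW p0) ?poweR_ge0//.
by apply: le_trans jnN; apply: ereal_sup_ubound; exists DQ.
Qed.

(** A single cube forms a family, and the volume factor of its summand is positive, so a finite norm
    forces a finite oscillation. *)
Lemma osc_lty Q : cube_set Q `<=` domain_set X -> (osc q Q f (proj Q) < +oo)%E.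
Proof.
move=> QX.
have fam : cube_families X ([set 0%N], fun=> Q).
  by split => //=; apply/trivIsetP => i j /= -> ->; rewrite eqxx.
have := esum_summand_le fam; rewrite /= esum_set1 ?jn_summand_ge0// jn_summandE.
move=> H; apply: (@lty_poweRy _ _ p) => //.
have v0 : 0 < cube_vol Q `^ (1 - alpha * p) by rewrite powR_gt0// cube_vol_gt0.
rewrite ltey; apply/negP => /eqP oscy.
by move: H; rewrite oscy gt0_muley ?lte_fin// leye_eq.
Qed.

Lemma open_cell_domain k x : Y x -> cube_set (C k x) `<=` domain_set X.
Proof. by move=> Yx; apply: subset_trans Yx; exact: open_cell0. Qed.

Lemma OE k x : Y x -> osc q (C k x) f (proj (C k x)) = (O k x)%:E.
Proof.
by move=> Yx; rewrite fineK// ge0_fin_numE ?osc_ge0// osc_lty//; exact: open_cell_domain.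
Qed.

Lemma O_ge0 k x : 0 <= O k x.
Proof. by rewrite fine_ge0// osc_ge0. Qed.

Lemma saturated_Y k : saturated o L k Y.
Proof.
move=> x y /(cell_no_le L0 (leq0n k)) yx; rewrite /Y/= /C.
by rewrite (open_cell_eq L0 yx).
Qed.

Lemma measurable_O k : measurable_fun setT (O k).
Proof.
rewrite (_ : O k = fun x => (fun j (_ : T) => O k (cell_point o L k j)) (cell_no o L k x) x).
  apply: (@measurable_piecewise _ _ o L L0 _ _ k (fun j _ => O k (cell_point o L k j))).
  by move=> j; exact: measurable_cst.
by apply/funext => x; rewrite /O /C open_cell_point.
Qed.

Lemma measurable_G k : measurable_fun setT (G k).
Proof.
rewrite (_ : G k = fun x => (fun j => poly_eval (proj (C k (cell_point o L k j))))
    (cell_no o L k x) x).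
  apply: (@measurable_piecewise _ _ o L L0 _ _ k
    (fun j => poly_eval (proj (C k (cell_point o L k j))))).
  by move=> j; exact: measurable_poly_eval.
by apply/funext => x; rewrite /G /C open_cell_point.
Qed.

Lemma vol_cell k x : cube_vol (C k x) = mesh L k ^+ n.
Proof. by []. Qed.

Lemma O_cell k x y : cell_no o L k y = cell_no o L k x -> O k y = O k x.
Proof. by move=> yx; rewrite /O /C (open_cell_eq L0 yx). Qed.

(** The integral is the sum over cells of |Q| O_k^p, and |Q| = |Q|^(alpha p) |Q|^(1 - alpha p): the
    first factor is the p-th power of [a k], the second is the one in the summand of the norm. *)
Lemma integral_O k :
  (\int[mu]_(x in Y) (`|O k x| `^ p)%:E <= ((a k * N) `^ p)%:E)%E.
Proof.
have satY := @saturated_Y k.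
rewrite (integral_saturated L0 satY); last 2 first.
- apply: measurable_powR_norm.
  by apply: measurable_funTS; exact: measurable_O.
- by move=> x _; rewrite lee_fin powR_ge0.
have fam := @cube_families_cells R n o L L0 k X Y (@open_cell_domain k).
have := esum_summand_le fam; rewrite /= => sumN.
rewrite (powRM _ _ N0) ?powR_ge0// EFinM.
apply: le_trans (lee_wpmul2l _ sumN); last by rewrite lee_fin powR_ge0.
rewrite -esumZl_nat ?powR_ge0//; last by move=> j; exact: jn_summand_ge0.
apply: le_esum => _ [x Yx <-]; rewrite open_cell_point -/(C k x) jn_summandE (OE k Yx).
rewrite vol_cell poweR_EFin -!EFinM mulrA -powRrM.
have v0 : 0 < mesh L k ^+ n by rewrite exprn_gt0// mesh_gt0.
rewrite -powRD; last by rewrite (gt_eqF v0) implybT.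
rewrite addrC subrK powRr1 ?(ltW v0)//.
rewrite (_ : (\int[mu]_(y in _) _)%E =
    \int[mu]_(y in cube_set (C k x)) (cst (O k x `^ p)%:E y))%E.
  by rewrite integral_cst ?measure_cube ?vol_cell -?EFinM 1?mulrC//; exact: measurable_cube.
apply: eq_integral => y /set_mem yx.
by rewrite (O_cell (cell_no_open yx)) ger0_norm// O_ge0.
Qed.

Let fin_le (x A u' v' : R) (u v : \bar R) : u = u'%:E -> v = v'%:E ->
  (x%:E <= A%:E * (u + v))%E -> x <= A * (u' + v').
Proof. by move=> -> ->; rewrite -EFinD -EFinM lee_fin. Qed.

(** The comparison of the two polynomials asks only for their degrees, so it also covers the coarse
    grids, where the truncated projection is 0. *)
Lemma G_diff k x : Y x -> `|G k.+1 x - G k x| <= K * (O k.+1 x + O k x).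
Proof.
move=> Yx; have mfC : measurable_fun (cube_set (C k x)) f.
  exact: measurable_funS (measurable_domain X) (open_cell_domain (k := k) Yx) mf.
apply: (fin_le (OE k.+1 Yx) (OE k Yx)).
exact: (KP q1 (@open_cellS R n o L L0 k x) (meshS L k) (msize_poly_proj_c0 (C k.+1 x))
  (msize_poly_proj_c0 (C k x)) mfC (@half_cell_closed R n o L L0 k.+1 x)).
Qed.

Let a0 : 0 <= a 0%N. Proof. exact: powR_ge0. Qed.

Let r_gt0 : 0 < r. Proof. by rewrite powR_gt0// exprn_gt0. Qed.

(** Strict because [n] and [alpha] are positive; this is what makes the telescoping sum of the G_k
    bounded. *)
Let r_lt1 : r < 1.
Proof.
rewrite /r powRN invf_lt1 ?powR_gt0 ?exprn_gt0//.
rewrite [ltLHS](_ : 1 = 1 `^ alpha); last by rewrite powR1.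
apply: gt0_ltr_powR; rewrite ?nnegrE ?exprn_ge0//.
by rewrite exprn_egt1 ?ltr1n// -lt0n.
Qed.

Lemma aE k : a k = a 0%N * r ^+ k.
Proof.
have v0 : 0 <= mesh L 0 ^+ n by rewrite exprn_ge0// ltW// mesh_gt0.
have i0 : 0 <= ((2 ^+ n)^-1 : R) ^+ k by rewrite exprn_ge0// invr_ge0 exprn_ge0.
rewrite /a (_ : mesh L k ^+ n = mesh L 0 ^+ n * ((2 ^+ n)^-1) ^+ k); last first.
  by rewrite /mesh expr0 divr1 expr_div_n -exprM exprVn -exprM mulnC.
rewrite powRM//; congr (_ * _); rewrite /r.
have w0 : 0 <= 2 ^+ n :> R by rewrite exprn_ge0.
move: (2 ^+ n) w0 i0 => w w0 i0.
have iw0 : 0 <= w^-1 by rewrite invr_ge0.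
rewrite -(powR_mulrn k iw0) powRAC (powR_mulrn k (powR_ge0 _ _)); congr (_ ^+ k).
by rewrite -[w^-1](powR_inv1 w0) -powRrM mulN1r.
Qed.

Lemma G0 x : G 0%N x = 0.
Proof.
by rewrite /G /proj /poly_proj_c0 /= /mesh expr0 divr1 ltNge c0L/= poly_eval0.
Qed.

Lemma integral_G k : (\int[mu]_(x in Y) (`|G k x| `^ p)%:E <=
  ((2 * K * a 0%N / (1 - r) * N) `^ p)%:E)%E.
Proof.
have mY : measurable Y := measurable_saturated L0 (@saturated_Y 0%N).
have mG j : measurable_fun Y (G j) by apply: measurable_funTS; exact: measurable_G.
have mO j : measurable_fun Y (O j) by apply: measurable_funTS; exact: measurable_O.
(* Partial sums of the geometric series with first term 2 K a_0 N and ratio r. Each Minkowski step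
   adds K (a_(k+1) + a_k) N = (1 + r) K a_0 N r^k, and the factor 2 absorbs 1 + r. *)
pose b j := 2 * K * a 0%N * N * ((1 - r ^+ j) / (1 - r)).
have r1 : 0 < 1 - r by rewrite subr_gt0.
have rj j : r ^+ j <= 1 by rewrite exprn_ile1// ltW.
have c_ge0 : 0 <= 2 * K * a 0%N * N by rewrite !mulr_ge0// ltW.
have b0 j : 0 <= b j by rewrite mulr_ge0// divr_ge0 ?subr_ge0 ?rj// ltW.
suff H : (\int[mu]_(x in Y) (`|G k x| `^ p)%:E <= (b k `^ p)%:E)%E.
  apply: (le_trans H); rewrite lee_fin; apply: ge0_ler_powR; rewrite ?nnegrE ?(ltW p0)//.
    by rewrite mulr_ge0// divr_ge0 ?(ltW r1)// !mulr_ge0// ltW.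
  rewrite /b [leRHS]mulrAC ler_wpM2l// ler_pdivrMr// mulVf ?gt_eqF//.
  by rewrite gerBl exprn_ge0// ltW.
elim: k => [|k IH].
  under eq_integral do rewrite G0 normr0 powR0//.
  by rewrite integral0 lee_fin powR_ge0.
have KO j : (\int[mu]_(x in Y) (`|K * O j x| `^ p)%:E <= ((K * (a j * N)) `^ p)%:E)%E.
  under eq_integral do rewrite normrM (ger0_norm (ltW K0)) powRM ?(ltW K0)// EFinM.
  rewrite ge0_integralZl//; last 2 first.
  - exact: measurable_powR_norm.
  - by rewrite lee_fin powR_ge0.
  rewrite powRM ?(ltW K0) ?mulr_ge0 ?powR_ge0// EFinM.
  by apply: lee_wpmul2l (integral_O j); rewrite lee_fin powR_ge0.
have aN0 j : 0 <= K * (a j * N) by rewrite !mulr_ge0 ?powR_ge0// ltW.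
have mKO j : measurable_fun Y (fun x => K * O j x) by exact: measurable_funM.
have mKOO : measurable_fun Y (fun x => K * O k.+1 x + K * O k x) by exact: measurable_funD.
have KOO : (\int[mu]_(x in Y) (`|K * O k.+1 x + K * O k x| `^ p)%:E <=
    ((K * (a k.+1 * N) + K * (a k * N)) `^ p)%:E)%E.
  apply: (minkowski_le mY p1 (aN0 _) (aN0 _) (mKO _) (mKO _)) => //.
  by move=> x _; exact: ler_normD.
apply: le_trans (minkowski_le mY p1 (b0 k) _ (mG k) mKOO (mG _) _ IH KOO) _.
- by rewrite addr_ge0.
- move=> x Yx; rewrite -lerBlDl.
  apply: le_trans (lerB_dist _ _) _; apply: (le_trans (G_diff k Yx)).
  by rewrite -mulrDr ler_norm.
rewrite lee_fin; apply: ge0_ler_powR; rewrite ?nnegrE ?(ltW p0) ?b0 ?addr_ge0//.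
have bS : b k.+1 = b k + 2 * K * a 0%N * N * r ^+ k.
  by rewrite /b exprS; field; rewrite gt_eqF.
rewrite bS lerD2l (aE k.+1) (aE k) exprS.
have -> : K * (a 0%N * (r * r ^+ k) * N) + K * (a 0%N * r ^+ k * N) =
   (1 + r) * (K * a 0%N * N * r ^+ k) by ring.
rewrite (_ : 2 * K * a 0%N * N * r ^+ k = 2 * (K * a 0%N * N * r ^+ k)); last by ring.
apply: ler_wpM2r; first by rewrite !mulr_ge0 ?exprn_ge0// ltW.
by rewrite [leRHS](_ : 2 = 1 + 1)// lerD2l ltW.
Qed.

(** [Y] is made of whole half-open cells and may contain points of a face outside the domain; there
    [f] is replaced by 0. *)
Let g := f \_ (domain_set X).

Lemma measurable_g : measurable_fun setT g.
Proof. exact/(measurable_restrictT _ (measurable_domain X)). Qed.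

(* [B] is a union of cells of every grid, so the cellwise bounds add up on [B]. *)
Lemma integral_diff_G (b : T) k : Y b ->
  (\int[mu]_(x in cell o L 0 (cell_no o L 0 b)) (`|g x - G k x|)%:E <=
    (mesh L 0 ^+ n * (mesh L 0 ^+ n)^-1 `^ p^-1 * (a 0%N * N) * r ^+ k)%:E)%E.
Proof.
move=> Yb; set B := cell _ _ _ _.
have BY : B `<=` Y by move=> x xb; exact: (@saturated_Y 0%N _ _ xb Yb).
have satB : saturated o L k B.
  by move=> x y /(cell_no_le L0 (leq0n k)) yx; rewrite /B /cell /= yx.
have mB : measurable B by exact: measurable_cell.
have mY : measurable Y := measurable_saturated L0 (@saturated_Y 0%N).
have mGB : measurable_fun B (fun x => `|g x - G k x|).
  apply: measurableT_comp => //; apply: measurable_funTS.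
  by apply: measurable_funB; [exact: measurable_g|exact: measurable_G].
have mOB : measurable_fun B (O k) by apply: measurable_funTS; exact: measurable_O.
have v0 : 0 < mesh L 0 ^+ n by rewrite exprn_gt0// mesh_gt0.
have muB : mu B = (mesh L 0 ^+ n)%:E by rewrite /B cellE measure_cube.
apply: (@le_trans _ _ (\int[mu]_(x in B) (O k x)%:E)%E).
  have m1 : measurable_fun B (fun x => (`|g x - G k x|)%:E) by exact/measurable_EFinP.
  have m2 : measurable_fun B (fun x => (O k x)%:E) by exact/measurable_EFinP.
  have n1 x : B x -> (0 <= (`|g x - G k x|)%:E)%E by rewrite lee_fin.
  have n2 x : B x -> (0 <= (O k x)%:E)%E by rewrite lee_fin O_ge0.
  rewrite (integral_saturated L0 satB m1 n1) (integral_saturated L0 satB m2 n2).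
  apply: le_esum => _ [x Bx <-]; rewrite open_cell_point -/(C k x).
  have Yx := BY x Bx; have CX := open_cell_domain (k := k) Yx.
  have mfC : measurable_fun (cube_set (C k x)) f.
    exact: measurable_funS (measurable_domain X) CX mf.
  have := average_le_osc (proj (C k x)) q1 mfC.
  rewrite OE// lee_pdivrMl ?cube_vol_gt0// => H.
  rewrite [leRHS](_ : _ = ((cube_vol (C k x))%:E * (O k x)%:E)%E); last first.
    rewrite [LHS](_ : _ = \int[mu]_(y in cube_set (C k x)) (cst (O k x)%:E y))%E.
      by rewrite integral_cst ?measure_cube 1?muleC//; exact: measurable_cube.
    by apply: eq_integral => y /set_mem yx; rewrite (O_cell (cell_no_open yx)).
  apply: le_trans H; rewrite le_eqVlt; apply/orP; left; apply/eqP.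
  apply: eq_integral => y /set_mem yx.
  by rewrite /g patchE ifT ?inE; [rewrite /G /C (open_cell_eq L0 (cell_no_open yx))|exact: CX].
(* The average over each cell being controlled by O_k, Jensen's inequality on [B], of finite
   measure, brings in the L^p bound of [integral_O]. *)
have := power_mean mB muB v0 p1 mOB (fun x _ => O_ge0 k x).
rewrite lee_pdivrMl// => H; apply: (le_trans H).
rewrite -!mulrA EFinM; apply: lee_wpmul2l; first by rewrite lee_fin ltW.
have iv0 : 0 <= (mesh L 0 ^+ n)^-1 by rewrite invr_ge0 ltW.
have I0 D (h : T -> R) : (forall x, 0 <= h x) -> (0 <= \int[mu]_(x in D) (h x)%:E)%E.
  by move=> h0; apply: integral_ge0 => x _; rewrite lee_fin.
rewrite poweRM; [|by rewrite lee_fin|by apply: I0 => x; exact: powR_ge0].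
rewrite EFinM poweR_EFin; apply: lee_wpmul2l; first by rewrite lee_fin powR_ge0.
have -> : a 0%N * (N * r ^+ k) = a k * N by rewrite (aE k) mulrAC mulrA.
have aN0 : 0 <= a k * N by rewrite mulr_ge0// powR_ge0.
rewrite -[leRHS](@poweRK R p) ?lee_fin//; apply: lee_poweR.
- by rewrite invr_ge0 ltW.
- by apply: I0 => x; exact: powR_ge0.
apply: le_trans (integral_O k).
have normO x : O k x = `|O k x| by rewrite ger0_norm// O_ge0.
under eq_integral do rewrite normO.
apply: ge0_subset_integral => //.
by apply: measurable_powR_norm => //; apply: measurable_funTS; exact: measurable_O.
Qed.

Lemma ae_cvg_G : exists Z, [/\ measurable Z, mu Z = 0%E &
  forall x, Y x -> ~ Z x -> (fun k => `|g x - G k x|) @ \oo --> 0].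
Proof.
(* The summability argument needs finite measure, so an exceptional set is found for each coarsest
   cell; their countable union is still null. *)
have cell_cvg j : exists Z, [/\ measurable Z, mu Z = 0%E &
  forall x, Y x -> cell o L 0 j x -> ~ Z x -> (fun k => `|g x - G k x|) @ \oo --> 0].
  have [[b Yb <-]|noY] := pselect (exists2 b, Y b & cell_no o L 0 b = j); last first.
    by exists set0; split => // x Yx xj; case: noY; exists x.
  have mB : measurable (cell o L 0 (cell_no o L 0 b)) by exact: measurable_cell.
  have mu_ k : measurable_fun (cell o L 0 (cell_no o L 0 b)) (fun x => `|g x - G k x|).
    apply: measurableT_comp => //; apply: measurable_funTS.
    by apply: measurable_funB; [exact: measurable_g|exact: measurable_G].
  have [|Z [mZ Z0 HZ]] := @ae_cvg0 _ T R mu _ mB (fun k x => `|g x - G k x|) mu_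
      (fun k x _ => normr_ge0 _).
    set c := mesh L 0 ^+ n * (mesh L 0 ^+ n)^-1 `^ p^-1 * (a 0%N * N).
    have c_ge0 : 0 <= c.
      by rewrite !mulr_ge0 ?powR_ge0// exprn_ge0// ltW// mesh_gt0.
    apply: (@le_lt_trans _ _ (c * (1 - r)^-1)%:E); last exact: ltry.
    apply: (@le_trans _ _ (\sum_(k <oo) (c * r ^+ k)%:E)%E).
      apply: lee_nneseries => k _; last exact: integral_diff_G.
      by move=> _; apply: integral_ge0 => x _; rewrite lee_fin.
    apply: lime_le.
      by apply: is_cvg_nneseries => k _ _; rewrite lee_fin mulr_ge0// exprn_ge0// ltW.
    apply: nearW => k; rewrite sumEFin lee_fin.
    by apply: (geometric_le_lim k c_ge0 r_gt0); rewrite ger0_norm// ltW.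
  by exists Z; split => // x _ xB; exact: HZ.
have [Z HZ] := choice cell_cvg.
exists (\bigcup_j Z j); split.
- by apply: bigcup_measurable => j _; have [] := HZ j.
- have mZ : measurable (\bigcup_j Z j).
    by apply: bigcup_measurable => j _; have [] := HZ j.
  apply/(negligibleP mu mZ); apply: negligible_bigcup => j.
  by apply/negligibleP; have [] := HZ j.
- move=> x Yx nZ; have [_ _] := HZ (cell_no o L 0 x); apply => //.
  by move=> Zx; apply: nZ; exists (cell_no o L 0 x).
Qed.

(** Off the null part of the domain outside [Y] and the exceptional set of the convergence, Fatou's
    lemma passes the uniform bound on the G_k to the limit. *)
Lemma integral_f_le : mu (domain_set X `\` Y) = 0%E ->
  (\int[mu]_(x in domain_set X) (`|f x| `^ p)%:E <=
    ((2 * K * a 0%N / (1 - r) * N) `^ p)%:E)%E.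
Proof.
move=> XY0; have [Z [mZ Z0 HZ]] := ae_cvg_G.
have mX := measurable_domain X.
have mY : measurable Y := measurable_saturated L0 (@saturated_Y 0%N).
have mYZ : measurable (Y `\` Z) by exact: measurableD.
have mN : measurable ((domain_set X `\` Y) `|` Z).
  by apply: measurableU => //; exact: measurableD.
have N_0 : mu ((domain_set X `\` Y) `|` Z) = 0%E.
  by apply: null_set_setU => //; exact: measurableD.
have mfp : measurable_fun (domain_set X) (fun x => (`|f x| `^ p)%:E).
  exact: measurable_powR_norm.
have mgp : measurable_fun setT (fun x => (`|g x| `^ p)%:E).
  by apply: measurable_powR_norm => //; exact: measurable_g.
rewrite (ge0_negligible_integral mN mX mfp _ N_0); last first.
  by move=> x _; rewrite lee_fin powR_ge0.
rewrite (_ : (\int[mu]_(x in _) _)%E =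
   (\int[mu]_(x in domain_set X `\` ((domain_set X `\` Y) `|` Z)) (`|g x| `^ p)%:E)%E); last first.
  by apply: eq_integral => x /set_mem[Xx _]; rewrite /g patchE ifT// inE.
apply: (@le_trans _ _ (\int[mu]_(x in Y `\` Z) (`|g x| `^ p)%:E)%E).
  apply: ge0_subset_integral => //.
  - exact: measurableD.
  - exact: measurable_funTS.
  - by move=> x [Xx /not_orP[nXY nZ]]; split => //; apply: contrapT => nY; apply: nXY.
have mg : measurable_fun (Y `\` Z) g by apply: measurable_funTS; exact: measurable_g.
have mG k : measurable_fun (Y `\` Z) (G k) by apply: measurable_funTS; exact: measurable_G.
apply: (fatou_powR mYZ p0 mg mG); first by move=> x [Yx nZ]; exact: HZ.
move=> k; apply: le_trans (integral_G k); apply: ge0_subset_integral => //.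
by apply: measurable_powR_norm => //; apply: measurable_funTS; exact: measurable_G.
Qed.

End estimates.

(** * The L^p bound by the jn norm and the equivalence of norms *)

Lemma mesh0 (R : realType) (L : R) : mesh L 0 = L.
Proof. by rewrite /mesh expr0 divr1. Qed.

Lemma Lp_norm_le_jn_norm (R : realType) (n : nat) (X : domain R n) (p q : R)
    (s : nat) (alpha c0 : R) :
  (0 < n)%N -> 1 <= p -> 1 <= q -> 0 < alpha -> 0 < c0 -> (c0%:E < domain_side X)%E ->
  exists2 M : R, 0 < M & forall f, measurable_fun (domain_set X) f ->
    (Lp_norm X p f <= M%:E * jn_norm c0 p q s alpha X f)%E.
Proof.
move=> n0 p1 q1 al0 c00 c0X; have p0 : 0 < p by rewrite (lt_le_trans ltr01).
have [K K0 KP] := @poly_diff_le_osc R n s.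
(* In the whole space any grid of mesh at least [c0] works, and the one of mesh [c0] at the origin
   is taken. For a cube the grid has its corner and side, so that the coarsest cell of an interior
   point is the open cube. *)
have [c [L [L0 [c0L XY0]]]] : exists (c : n.-tuple R) (L : R) (L0 : 0 < L), c0 <= L /\
    lebesgue_measure_tuple n (domain_set X `\`
      [set x | cube_set (open_cell c L0 0 x) `<=` domain_set X]) = 0%E.
  case: X c0X => [_|Q c0Q].
    exists [tuple 0 | _ < n], c0, c00; split => //.
    by rewrite (_ : _ `\` _ = set0) ?measure0//; apply/seteqP; split => // x [_]; apply.
  exists (cube_corner Q), (cube_side Q), (cube_side_gt0 Q); split.
    by apply: ltW; rewrite -lte_fin.
  set Y := [set x | _].
  have sub : cube_set (open_cube Q) `<=` Y.
    move=> x Qx y xy; apply: open_cube_sub => i.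
    have idx0 j : cell_idx (cube_corner Q) (cube_side Q) 0 x j = 0.
      apply/(cell_idxP _ (cube_side_gt0 Q)); rewrite mesh0 mul0r addr0.
      by have := Qx j; rewrite /= in_itv/= => /andP[/ltW -> ->].
    have := xy i; rewrite /= !in_itv/= tnth_mktuple idx0 mesh0 mul0r addr0.
    exact.
  have mQ := measurable_cube Q; have mQ' := measurable_cube (open_cube Q).
  have mY : measurable Y.
    apply: (measurable_saturated (o := cube_corner Q) (cube_side_gt0 Q) (k := 0%N)).
    by move=> x y yx; rewrite /Y/= (open_cell_eq (cube_side_gt0 Q) yx).
  apply: (subset_measure0 _ _ (setDS sub)); [exact: measurableD|exact: measurableD|].
  by apply: measure_subcubeD => //; exact: open_cube_sub.
set M := 2 * K * (mesh L 0 ^+ n) `^ alpha / (1 - (2 ^+ n) `^ (- alpha)).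
have M0 : 0 <= M.
  rewrite divr_ge0 ?mulr_ge0 ?powR_ge0 ?(ltW K0)// subr_ge0 powRN invf_le1 ?powR_gt0 ?exprn_gt0//.
  rewrite [leLHS](_ : 1 = 1 `^ alpha); last by rewrite powR1.
  apply: ge0_ler_powR; rewrite ?nnegrE ?exprn_ge0 ?(ltW al0)//.
  by rewrite exprn_ege1// ler1n.
exists (M + 1); first by rewrite ltr_wpDl.
move=> f mf; have jn0 : (0 <= jn_norm c0 p q s alpha X f)%E by exact: norm_with_ge0.
have [jny|] := eqVneq (jn_norm c0 p q s alpha X f) +oo%E.
  by rewrite jny gt0_muley ?leey// lte_fin ltr_wpDl.
rewrite -ltey => jn_fin.
pose N := fine (jn_norm c0 p q s alpha X f).
have NE : jn_norm c0 p q s alpha X f = N%:E by rewrite fineK// ge0_fin_numE.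
have N0 : 0 <= N by rewrite fine_ge0.
have jnN : (jn_norm c0 p q s alpha X f <= N%:E)%E by rewrite NE.
have := integral_f_le n0 p1 q1 al0 c0L K0 KP mf N0 jnN XY0.
rewrite -/M -Lp_norm_pow// NE -EFinM => H.
rewrite -[leLHS](@poweRK R p) ?gt_eqF ?Lnorm_ge0//.
apply: (le_trans (lee_poweR _ _ H)).
- by rewrite invr_ge0 ltW.
- exact: poweR_ge0.
have pp : p * p^-1 = 1 by rewrite divff// gt_eqF.
rewrite poweR_EFin -powRrM pp powRr1; last exact: mulr_ge0.
rewrite lee_fin.
by rewrite ler_wpM2r// lerDl.
Qed.

Theorem proposition2p11 (R : realType) (n : nat) (hn : (0 < n)%N)
    (X : domain R n) (p q : R) (hp : 1 < p) (hq : 1 <= q <= p) (s : nat)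
    (alpha : R) (halpha : 0 < alpha)
    (c0 : R) (hc0 : 0 < c0) (hc0X : (c0%:E < domain_side X)%E) :
  jn c0 p q s alpha X = JN p q s alpha X `&` Lp X p /\
  exists A B : R, [/\ 0 < A, 0 < B &
    forall f, jn c0 p q s alpha X f ->
      (A%:E * maxe (JN_norm p q s alpha X f) (Lp_norm X p f)
         <= jn_norm c0 p q s alpha X f)%E /\
      (jn_norm c0 p q s alpha X f
         <= B%:E * maxe (JN_norm p q s alpha X f) (Lp_norm X p f))%E].
Proof.
have /andP[q1 qp] := hq; have p0 : 0 < p by rewrite (lt_trans ltr01).
have [C C0 JNjn] := @JN_norm_le_jn_norm R n X p q s alpha c0 p0 q1.
have [M M0 Lpjn] := Lp_norm_le_jn_norm s hn (ltW hp) q1 halpha hc0 hc0X.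
have [B B0 jnmax] := @jn_norm_le_max R n X p q s alpha c0 q1 qp halpha hc0.
split.
  apply/seteqP; split => f.
    move=> [loc_f jn_fin]; have mf := loc_f.1; split.
      split; first exact: loc_f.
      apply: (le_lt_trans (JNjn f mf)).
      by rewrite lte_mul_pinfty ?lee_fin ?(ltW C0).
    rewrite /Lp/= inE/=; apply/andP; split; rewrite inE/=.
      by apply/(measurable_restrictT _ (measurable_domain X)).
    rewrite /finite_norm; apply: (le_lt_trans (Lpjn f mf)).
    by rewrite lte_mul_pinfty ?lee_fin ?(ltW M0).
  move=> [[loc_f JN_fin] Lpf]; have mf := loc_f.1; split; first exact: loc_f.
  have Lp_fin : (Lp_norm X p f < +oo)%E.
    by move: Lpf; rewrite /Lp/= inE => /andP[_]; rewrite inE.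
  apply: (le_lt_trans (jnmax f mf)).
  have max_fin : (maxe (JN_norm p q s alpha X f) (Lp_norm X p f) < +oo)%E.
    by rewrite gt_max JN_fin.
  by rewrite lte_mul_pinfty ?lee_fin ?(ltW B0).
(* The JN norm is at most [C] times the jn norm and the L^p norm at most [M] times, so [C + M]
   serves for their maximum. *)
exists (C + M)^-1, B; split => //; first by rewrite invr_gt0 addr_gt0.
move=> f [loc_f _]; have mf := loc_f.1; split; last exact: jnmax.
rewrite lee_pdivrMl ?addr_gt0// ge_max; apply/andP; split.
  apply: (le_trans (JNjn f mf)); apply: lee_wpmul2r; first exact: norm_with_ge0.
  by rewrite lee_fin lerDl ltW.
apply: (le_trans (Lpjn f mf)); apply: lee_wpmul2r; first exact: norm_with_ge0.
by rewrite lee_fin lerDr ltW.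
Qed.
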